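(* Let $R$ be a Noetherian normal domain, let $B=R[X_1,\dots,X_n]$ be a polynomial ring in $n$ variables over $R$, and let $A$ be an $R$-subalgebra of $B$. Then the following are equivalent: (I) $A$ is a retract of $B$ and $A=B^{\phi}$ for some exponential map $\phi\in\operatorname{Exp}_A(B)$ with $\phi\neq \mathrm{Id}$; (II) $B\cong \operatorname{Sym}_A(IA)$ as $A$-algebras for some invertible ideal $I$ of $R$.
   Context: A subring $A$ of a ring $B$ is a retract of $B$ if there is an idempotent ring endomorphism $\pi:B\to B$ with $\pi(B)=A$. For a ring $B$ and an indeterminate $U$, an exponential map on $B$ (over a ring $C\subseteq B$) is a $C$-algebra homomorphism $\phi_U: B\to B[U]$ such that (i) composing with evaluation at $U=0$ gives the identity on $B$, and (ii) $\phi_V\phi_U=\phi_{V+U}$, where $\phi_V:B\to B[V]$ is extended to $B[U]\to B[V,U]$ by $\phi_V(U)=U$. $\operatorname{Exp}_C(B)$ is the set of such maps; $\phi\neq\mathrm{Id}$ means $\phi$ is not the map $b\mapsto b$. The ring of invariants is $B^{\phi}=\{b\in B:\phi(b)=b\}$. $\operatorname{Sym}_A(M)$ denotes the symmetric algebra of an $A$-module $M$. *)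

(* Defs.v *)
From HB Require Import structures.
From mathcomp Require Import all_boot all_order all_algebra.
From mathcomp Require Import fraction.
Set Implicit Arguments. Unset Strict Implicit. Unset Printing Implicit Defensive.
Import Order.TTheory GRing.Theory Num.Theory.
Local Open Scope ring_scope.

Fixpoint mpoly (R : idomainType) (n : nat) : idomainType :=
  match n with
  | 0 => R
  | n'.+1 => ({poly (mpoly R n')} : idomainType)
  end.

Fixpoint mpolyC (R : idomainType) (n : nat) : R -> mpoly R n :=
  match n return R -> mpoly R n with
  | 0 => fun r => r
  | n'.+1 => fun r => (mpolyC n' r)%:P
  end.

Definition is_ideal (R : comNzRingType) (I : R -> Prop) : Prop :=
  [/\ I 0, (forall x y, I x -> I y -> I (x + y)) & (forall r x, I x -> I (r * x))].

Definition finitely_generated_ideal (R : comNzRingType) (I : R -> Prop) : Prop :=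
  exists s : seq R, forall x,
    I x <-> exists c : nat -> R, x = \sum_(i < size s) c i * s`_i.

Definition noetherian (R : comNzRingType) : Prop :=
  forall I : R -> Prop, is_ideal I -> finitely_generated_ideal I.

Definition integral_over_domain (R : idomainType) (x : {fraction R}) : Prop :=
  exists p : {poly R}, p \is monic /\ root (map_poly (@FracField.tofrac R) p) x.

Definition normal_domain (R : idomainType) : Prop :=
  forall x : {fraction R}, integral_over_domain x ->
    exists r : R, x = @FracField.tofrac R r.

Definition invertible_ideal (R : idomainType) (I : R -> Prop) : Prop :=
  is_ideal I /\
  exists J : {fraction R} -> Prop,
    (J 0 /\ (forall x y, J x -> J y -> J (x + y)) /\
     (forall (r : R) x, J x -> J (@FracField.tofrac R r * x))) /\
    (exists d : R, d != 0 /\ forall x, J x ->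
        exists r : R, @FracField.tofrac R d * x = @FracField.tofrac R r) /\
    (forall i y, I i -> J y ->
        exists r : R, @FracField.tofrac R i * y = @FracField.tofrac R r) /\
    (exists s : seq (R * {fraction R}),
        (forall p, p \in s -> I p.1 /\ J p.2) /\
        \sum_(p <- s) @FracField.tofrac R p.1 * p.2 = 1).

Definition R_subalgebra (R : idomainType) (n : nat) (A : mpoly R n -> Prop) : Prop :=
  [/\ (forall r, A (mpolyC n r)),
      (forall x y, A x -> A y -> A (x + y)),
      (forall x, A x -> A (- x)) &
      (forall x y, A x -> A y -> A (x * y))].

Definition is_retract (B : nzRingType) (A : B -> Prop) : Prop :=
  exists pi : {rmorphism B -> B},
    (forall b, pi (pi b) = pi b) /\ (forall b, A b <-> exists c, pi c = b).

(* phi_U : B -> B[U] is an exponential map on B over A (phi in Exp_A(B)):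
   an A-algebra morphism (ring morphism fixing A) such that
   (i)  phi(b) evaluated at U = 0 is b, and
   (ii) phi_V phi_U = phi_{V+U}; we represent B[V,U] as {poly {poly B}}
        (outer variable U, inner variable V); phi_V extended to B[U] is
        map_poly phi, and phi_{V+U}(b) is phi(b) with U replaced by V+U. *)
Definition is_exp_map (B : comNzRingType) (A : B -> Prop)
    (phi : {rmorphism B -> {poly B}}) : Prop :=
  [/\ (forall a, A a -> phi a = a%:P),
      (forall b, (phi b).[0] = b) &
      (forall b, map_poly phi (phi b) = (phi b)^:P \Po ('X + ('X)%:P))].

Definition invariants (B : comNzRingType) (phi : B -> {poly B}) (b : B) : Prop :=
  phi b = b%:P.

Definition ext_ideal (R : idomainType) (n : nat) (I : R -> Prop)
    (A : mpoly R n -> Prop) (x : mpoly R n) : Prop :=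
  exists s : seq (R * mpoly R n),
    (forall p, p \in s -> I p.1 /\ A p.2) /\
    x = \sum_(p <- s) mpolyC n p.1 * p.2.

(* Symmetric algebras via their universal property.                          *)
(* Given a subring A of B and an A-submodule M of B, [is_sym_alg A M j]      *)
(* says that j : M -> B is A-linear and (B, j) is a symmetric algebra of the *)
(* A-module M over A, where B is an A-algebra via the inclusion A -> B:      *)
(* for every commutative A-algebra T (structure map sigma, a ring morphism   *)
(* on A) and every A-linear f : M -> T, there is a unique A-algebra morphism *)
(* g : B -> T with g o j = f on M.  Hence B ~ Sym_A(M) as A-algebras iff     *)
(* such a j exists.                                                          *)
Definition is_sym_alg (B : comNzRingType) (A M : B -> Prop) (j : B -> B) : Prop :=
  (forall x y, M x -> M y -> j (x + y) = j x + j y) /\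
  (forall a x, A a -> M x -> j (a * x) = a * j x) /\
  forall (T : comNzRingType) (sigma : B -> T) (f : B -> T),
    sigma 1 = 1 ->
    (forall a b, A a -> A b -> sigma (a + b) = sigma a + sigma b) ->
    (forall a b, A a -> A b -> sigma (a * b) = sigma a * sigma b) ->
    (forall x y, M x -> M y -> f (x + y) = f x + f y) ->
    (forall a x, A a -> M x -> f (a * x) = sigma a * f x) ->
    (exists g : {rmorphism B -> T},
        (forall a, A a -> g a = sigma a) /\ (forall x, M x -> g (j x) = f x)) /\
    (forall g1 g2 : {rmorphism B -> T},
        (forall a, A a -> g1 a = sigma a) -> (forall x, M x -> g1 (j x) = f x) ->
        (forall a, A a -> g2 a = sigma a) -> (forall x, M x -> g2 (j x) = f x) ->
        forall b, g1 b = g2 b).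

(* Main.v *)
(** Localizing [B] at the nonzero constants of [R] gives a factorial domain. For (I) => (II),
    let [pi] be the retraction onto [A = B^phi] and [P] its kernel, a nonzero prime ideal
    meeting [R] only in [0]; it contains an element [F] that is prime up to constants.
    Leading coefficients of [phi b] are invariant, so [F] and any [h] in [P] are
    algebraically dependent over [A], which forces [F] to divide [h] up to a constant. As
    [R] is Noetherian and normal, the content formula then shows that [F] divides [c h] in
    [B] for every coefficient [c] of [F]. Hence [b |-> c (b - pi b) / F] maps [B] to [B]; it
    lowers the degree of [phi b], and applying these maps to the monomials of [F] yields
    elements [r_i] with [sum_i c_i r_i = d], where [d] is a nonzero coefficient of [F].
    So [I = {r | d divides r F}] is invertible with inverse generated by the [c_i / d], and
    [x |-> x F / d] makes [B] the symmetric algebra of [IA].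

    For (II) => (I), the zero map [IA -> A] extends to the retraction and the inclusion
    [IA -> A] to the translation [j x |-> j x + x U]; over the fraction field, translating
    by [- j i / i] gives back the retraction, so that invariants lie in [A]. *)
Require Import Defs.
From HB Require Import structures.
From mathcomp Require Import all_boot all_order all_algebra.
From mathcomp Require Import fraction zify ring boolp.
Set Implicit Arguments. Unset Strict Implicit. Unset Printing Implicit Defensive.
Import GRing.Theory.
Local Open Scope ring_scope.

(** * Factoriality up to a multiplicative set *)

Definition prime_pred (D : comNzRingType) (Q : D -> Prop) : Prop :=
  is_ideal Q /\ forall x y, Q (x * y) -> Q x \/ Q y.

Lemma ideal_sum (D : comNzRingType) (Q : D -> Prop) (I : eqType) (r : seq I)
    (P : pred I) (F : I -> D) :
  is_ideal Q -> (forall i, i \in r -> P i -> Q (F i)) -> Q (\sum_(i <- r | P i) F i).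
Proof.
case=> Q0 QD _ QF; rewrite big_seq_cond; apply: (big_ind Q) => //.
by move=> i /andP[ir Pi]; apply: QF.
Qed.

Lemma ideal_opp (D : comNzRingType) (Q : D -> Prop) x : is_ideal Q -> Q x -> Q (- x).
Proof. by case=> _ _ QM Qx; rewrite -mulN1r; apply: QM. Qed.

Lemma ideal_addl (D : comNzRingType) (Q : D -> Prop) x y :
  is_ideal Q -> Q x -> Q (x + y) -> Q y.
Proof.
move=> idQ Qx Qxy; have [_ QD _] := idQ.
by rewrite -[y](addKr x); apply: QD => //; apply: ideal_opp.
Qed.

(** If [f] and [g] both had coefficients outside [Q], take the least such indices [i] and [j]:
    modulo [Q], the coefficient of [f * g] at [i + j] is the product of those two. *)
Lemma prime_poly (D : comNzRingType) (Q : D -> Prop) :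
  prime_pred Q -> prime_pred (fun f : {poly D} => forall k, Q f`_k).
Proof.
case=> idQ prQ; have [Q0 QD QM] := idQ; split.
  split=> [k|f g Qf Qg k|f g Qg k]; first by rewrite coef0.
  - by rewrite coefD; apply: QD.
  - by rewrite coefM; apply: ideal_sum => // i _ _; apply: QM.
move=> f g Qfg; apply: contrapT => /not_orP[/existsNP nf /existsNP ng].
have exf : exists i, `[< ~ Q f`_i >] by case: nf => i ?; exists i; apply/asboolP.
have exg : exists i, `[< ~ Q g`_i >] by case: ng => i ?; exists i; apply/asboolP.
case: (ex_minnP exf) => i /asboolP nQi mini.
case: (ex_minnP exg) => j /asboolP nQj minj.
have Qlt (h : {poly D}) m : (forall k, `[< ~ Q h`_k >] -> (m <= k)%N) ->
    forall k, (k < m)%N -> Q h`_k.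
  move=> minm k ltkm; apply: contrapT => nQk.
  by have := minm k (asboolT nQk); rewrite leqNgt ltkm.
have /prQ[//|//] : Q (f`_i * g`_j).
have := Qfg (i + j)%N; rewrite coefM.
have ltij : (i < (i + j).+1)%N by rewrite ltnS leq_addr.
rewrite (bigD1 (Ordinal ltij)) //= addKn addrC; apply: ideal_addl => //.
apply: ideal_sum => // k _ neki; have [ltki|leik] := ltnP k i.
  by rewrite mulrC; apply: QM; apply: Qlt mini _ _.
have ltik : (i < k)%N by rewrite ltn_neqAle leik andbT eq_sym.
apply: QM; apply: Qlt minj _ _.
by rewrite ltn_subLR ?ltn_add2r // -ltnS.
Qed.

Definition mult_set (D : idomainType) (S : D -> Prop) : Prop :=
  [/\ S 1, (forall x y, S x -> S y -> S (x * y)) & (forall x, S x -> x != 0)].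

(* Divisibility in the localization at [S], expressed without denominators. *)
Definition dvd_upto (D : idomainType) (S : D -> Prop) (p x : D) : Prop :=
  exists s e, S s /\ s * x = p * e.

(* Units of the localization count as primes here. *)
Definition prime_upto (D : idomainType) (S : D -> Prop) (p : D) : Prop :=
  p != 0 /\ forall x y, dvd_upto S p (x * y) -> dvd_upto S p x \/ dvd_upto S p y.

(** The elements [s] and [t] stand for a unit of the localization. *)
Definition factorization_upto (D : idomainType) (S : D -> Prop) (x : D) (ps : seq D) : Prop :=
  (forall p, p \in ps -> prime_upto S p) /\
  exists s t, [/\ S s, S t & s * x = t * \prod_(p <- ps) p].

Definition factorial_upto (D : idomainType) (S : D -> Prop) : Prop :=
  forall x, x != 0 -> exists ps, factorization_upto S x ps.

(** Localizing [{poly D}] at these constants gives the polynomial ring over the localization of [D]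
    at [S]. *)
Definition constS (D : idomainType) (S : D -> Prop) (f : {poly D}) : Prop :=
  exists2 s, S s & f = s%:P.

Section Divisibility.
Variables (D : idomainType) (S : D -> Prop).
Hypothesis multS : mult_set S.

Lemma dvd_upto_ideal p : is_ideal (dvd_upto S p).
Proof.
case: multS => S1 SM _; split.
- by exists 1, 0; split=> //; ring.
- move=> x y [s [e [Ss E]]] [t [e' [St E']]].
  exists (s * t), (t * e + s * e'); split; first exact: SM.
  transitivity (t * (s * x) + s * (t * y)); first by ring.
  by rewrite E E'; ring.
- move=> r x [s [e [Ss E]]]; exists s, (r * e); split=> //.
  by rewrite mulrCA E; ring.
Qed.

Lemma dvd_upto_scale p s x : S s -> dvd_upto S p (s * x) -> dvd_upto S p x.
Proof.
case: multS => _ SM _ Ss [t [e [St E]]]; exists (t * s), e.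
by split; [apply: SM | rewrite -mulrA].
Qed.

End Divisibility.

Section Factorial.
Variables (D : idomainType) (S : D -> Prop).
Hypothesis multS : mult_set S.

Lemma mult_constS : mult_set (constS S).
Proof.
case: multS => S1 SM S0; split; first by exists 1.
- by move=> _ _ [s Ss ->] [t St ->]; exists (s * t); [apply: SM | rewrite polyCM].
- by move=> _ [s Ss ->]; rewrite polyC_eq0; apply: S0.
Qed.

Lemma dvd_upto_polyC p (f : {poly D}) :
  dvd_upto (constS S) p%:P f <-> forall k, dvd_upto S p f`_k.
Proof.
case: multS => S1 SM _; split=> [[_ [e [[s Ss ->] E]]] k|].
  by exists s, e`_k; split=> //; rewrite -!coefCM E.
elim/poly_ind: f => [_|f c IHf dvdf].
  by exists 1, 0; rewrite !mulr0; split=> //; exists 1.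
have [k|_ [e [[s Ss ->] E]]] := IHf.
  by have := dvdf k.+1; rewrite coefD coefMX coefC /= addr0.
have [t [e' [St E']]] : dvd_upto S p c.
  by have := dvdf 0; rewrite coefD coefMX coefC /= add0r.
exists (s * t)%:P, (t%:P * e * 'X + s%:P * e'%:P); split.
  by exists (s * t) => //; apply: SM.
transitivity (t%:P * (s%:P * f) * 'X + s%:P * (t * c)%:P); first by ring.
by rewrite E E'; ring.
Qed.

Lemma prime_upto_polyC p : prime_upto S p -> prime_upto (constS S) p%:P.
Proof.
case=> p0 prp; split; first by rewrite polyC_eq0.
have [_ prpoly] := prime_poly (conj (dvd_upto_ideal multS p) prp).
move=> f g /dvd_upto_polyC /prpoly[] dvd; [left | right]; exact/dvd_upto_polyC.
Qed.

(** Each [p] in [ps] stays prime as a constant, so it divides [q] or [e] and cancels there, at the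
    cost of a denominator in [S]. Factorizations over the fraction field thus descend to the
    localization. *)
Lemma gauss_split (ps : seq D) (f q e : {poly D}) :
  (forall p, p \in ps -> prime_upto S p) -> (\prod_(p <- ps) p) *: f = q * e ->
  exists s (q' e' : {poly D}), [/\ S s, s *: f = q' * e', size q' = size q & size e' = size e].
Proof.
case: multS => S1 SM S0.
have nz s : S s -> s != 0 by apply: S0.
elim: ps f q e => [|p ps IHps] f q e prps.
  by rewrite big_nil => E; exists 1, q, e.
have [p0 _] := prps p (mem_head _ _).
have prps' p' : p' \in ps -> prime_upto S p'.
  by move=> ?; apply: prps; rewrite inE orbC; apply/orP; left.
rewrite big_cons => E.
have [_ prp] := prime_upto_polyC (prps p (mem_head _ _)).
have dvdqe : dvd_upto (constS S) p%:P (q * e).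
  exists 1, ((\prod_(p <- ps) p) *: f); split; first by exists 1.
  by rewrite -E mul1r -!mul_polyC; ring.
have cancelp (u v w : {poly D}) (s : D) : s *: u = p *: w -> (p * \prod_(p <- ps) p) *: f = u * v ->
    (\prod_(p <- ps) p) *: (s *: f) = w * v.
  move=> Eu Ef; apply: (mulfI (_ : p%:P != 0)); first by rewrite polyC_eq0.
  move: Eu Ef; rewrite -!mul_polyC => Eu Ef.
  transitivity (s%:P * ((p * \prod_(p <- ps) p)%:P * f)); first by ring.
  by rewrite Ef mulrA Eu; ring.
have [[_ [w [[s Ss ->] Ew]]]|[_ [w [[s Ss ->] Ew]]]] := prp _ _ dvdqe;
  rewrite !mul_polyC in Ew.
- have [t [q' [e' [St E' sq se]]]] := IHps _ _ _ prps' (cancelp _ _ _ _ Ew E).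
  exists (t * s), q', e'; split=> //; first exact: SM.
    by rewrite -scalerA.
  by rewrite sq -(size_scale w p0) -Ew size_scale ?nz.
- rewrite [q * e]mulrC in E.
  have [t [q' [e' [St E' sq se]]]] := IHps _ _ _ prps' (cancelp _ _ _ _ Ew E).
  exists (t * s), e', q'; split=> //; first exact: SM.
  + by rewrite -scalerA E' mulrC.
  + by rewrite sq -(size_scale w p0) -Ew size_scale ?nz.
Qed.

(** No [p] in [ps] divides [f], so each one divides the cofactor [e] and can be cancelled from
    it. *)
Lemma gauss_cancel (ps : seq D) (f g e : {poly D}) :
  (forall p, p \in ps -> prime_upto S p) ->
  (forall p, p \in ps -> ~ dvd_upto (constS S) p%:P f) ->
  (\prod_(p <- ps) p) *: g = f * e -> dvd_upto (constS S) f g.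
Proof.
case: multS => S1 SM S0.
elim: ps g e => [|p ps IHps] g e prps ndvd.
  by rewrite big_nil scale1r => E; exists 1, e; split; [exists 1|rewrite mul1r].
have [p0 _] := prps p (mem_head _ _); rewrite big_cons => E.
have [_ prp] := prime_upto_polyC (prps p (mem_head _ _)).
have dvdfe : dvd_upto (constS S) p%:P (f * e).
  exists 1, ((\prod_(p <- ps) p) *: g); split; first by exists 1.
  by rewrite -E mul1r -!mul_polyC; ring.
have [/(ndvd _ (mem_head _ _))[]|[_ [w [[s Ss ->] Ew]]]] := prp _ _ dvdfe.
have E' : (\prod_(p <- ps) p) *: (s *: g) = f * w.
  apply: (mulfI (_ : p%:P != 0)); first by rewrite polyC_eq0.
  move: E Ew; rewrite -!mul_polyC => E Ew.
  transitivity (s%:P * ((p * \prod_(p <- ps) p)%:P * g)); first by ring.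
  by rewrite E mulrCA Ew; ring.
apply: (dvd_upto_scale mult_constS (s := s%:P)); first by exists s.
rewrite mul_polyC; apply: IHps E' => p' p'ps.
  by apply: prps; rewrite inE p'ps orbT.
by apply: ndvd; rewrite inE p'ps orbT.
Qed.

Lemma factorization_upto_lift (s : D) (f : {poly D}) ps :
  S s -> factorization_upto (constS S) (s *: f) ps -> factorization_upto (constS S) f ps.
Proof.
have [_ cSM _] := mult_constS => Ss [prps [t [u [St Su E]]]]; split=> //.
exists (t * s%:P), u; split=> //; first by apply: cSM => //; exists s.
by rewrite -E -mul_polyC mulrA.
Qed.

Lemma factorization_upto_mul (q e : {poly D}) ps qs :
  factorization_upto (constS S) q ps -> factorization_upto (constS S) e qs ->
  factorization_upto (constS S) (q * e) (ps ++ qs).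
Proof.
have [_ cSM _] := mult_constS.
move=> [prps [s [t [Ss St E]]]] [prqs [s' [t' [Ss' St' E']]]]; split.
  by move=> p; rewrite mem_cat => /orP[]; [apply: prps | apply: prqs].
exists (s * s'), (t * t'); split; [exact: cSM | exact: cSM |].
by rewrite big_cat /= mulrACA E E' mulrACA.
Qed.

Lemma factorization_upto_polyC c ps :
  factorization_upto S c ps -> factorization_upto (constS S) c%:P (map polyC ps).
Proof.
move=> [prps [s [t [Ss St E]]]]; split.
  by move=> _ /mapP[p /prps prp ->]; apply: prime_upto_polyC.
exists s%:P, t%:P; split; [by exists s | by exists t |].
by rewrite big_map -rmorph_prod -!polyCM E.
Qed.

Lemma factorization_upto_prime (f : {poly D}) :
  prime_upto (constS S) f -> factorization_upto (constS S) f [:: f].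
Proof.
have [cS1 _ _] := mult_constS => prf; split; first by move=> p; rewrite inE => /eqP ->.
by exists 1, 1; split=> //; rewrite big_seq1.
Qed.

Local Notation dvdp := Pdiv.Idomain.dvdp.

(** Here [dvdp] is pseudo-divisibility, that is, divisibility over the fraction field, where gcds
    are available. *)
Lemma irreducible_dvd_mul (f g h : {poly D}) : irreducible_poly f ->
  dvdp f (g * h) -> dvdp f g \/ dvdp f h.
Proof.
move=> irrf dvd.
have [cop|/eqP ncop] := boolP (size (Pdiv.Idomain.gcdp f g) == 1%N).
  by right; rewrite -(Pdiv.Idomain.Gauss_dvdpr h (cop : Pdiv.Idomain.coprimep f g)).
left; have := irrf.2 _ (introN eqP ncop) (Pdiv.Idomain.dvdp_gcdl f g).
by rewrite Pdiv.Idomain.eqp_sym => /andP[/Pdiv.Idomain.dvdp_trans->] //; apply: Pdiv.Idomain.dvdp_gcdr.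
Qed.

(** Gauss's theorem, by induction on the degree of [f] and then on the number of primes in a
    factorization of its leading coefficient. *)
Lemma factorial_upto_poly : factorial_upto S -> factorial_upto (constS S).
Proof.
have [S1 SM S0] := multS => facS f.
have [n] := ubnP (size f); elim: n f => // n IHn f; rewrite ltnS => szf f0.
have lf0 : lead_coef f != 0 by rewrite lead_coef_eq0.
have [ps] := facS _ lf0; have [m] := ubnP (size ps) => szps [prps [s [t [Ss St E]]]].
elim: m ps szps f s t Ss St E prps szf f0 {lf0} => // m IHm ps szps f s t Ss St E prps szf f0.
(* A prime of the leading coefficient that divides [f] is split off; the leading coefficient of the
   quotient has one prime fewer. *)
have [[p pps [_ [G [[u Su ->] EG]]]]|prim] :=
    pselect (exists2 p, p \in ps & dvd_upto (constS S) p%:P f).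
  rewrite !mul_polyC in EG; have [p0 _] := prps p pps.
  have prp : factorization_upto (constS S) p%:P [:: p%:P].
    by apply/factorization_upto_prime/prime_upto_polyC/prps.
  have eqsz : size G = size f.
    by rewrite -(size_scale G p0) -EG size_scale ?S0.
  have G0 : G != 0 by rewrite -size_poly_eq0 eqsz size_poly_eq0.
  have [||||||qs facG] := IHm (rem p ps) _ G s (u * t) _ _ _ _ _ G0 => //.
  - by rewrite size_rem // -ltnS (leq_trans _ szps) // prednK //; case: (ps) pps.
  - exact: SM.
  - apply: (mulfI p0).
    transitivity (s * (p * lead_coef G)); first by ring.
    rewrite -lead_coefZ -EG lead_coefZ mulrCA E (big_rem p) //=; ring.
  - by move=> q /mem_rem; apply: prps.
  - by rewrite eqsz.
  exists ([:: p%:P] ++ qs); apply: (factorization_upto_lift Su).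
  by rewrite EG -mul_polyC; apply: factorization_upto_mul.
have primf p : p \in ps -> ~ dvd_upto (constS S) p%:P f by move=> pps dvd; apply: prim; exists p.
(* Pseudo-division multiplies [g] by a power of the leading coefficient of [f], hence by primes of
   [ps] up to [S]; none of them divides [f], so all of them cancel. *)
have cancel g : dvdp f g -> dvd_upto (constS S) f g.
  rewrite Pdiv.Idomain.dvdp_eq => /eqP; set k := scalp g f; set q := Pdiv.Idomain.divp _ _ => Eg.
  have SX r i : S r -> S (r ^+ i).
    by move=> Sr; elim: i => [|i IHi]; rewrite ?expr0 // exprS; apply: SM.
  apply: (dvd_upto_scale mult_constS (s := (t ^+ k)%:P)); first by exists (t ^+ k) => //; apply: SX.
  apply: (@gauss_cancel (flatten (nseq k ps)) _ _ ((s ^+ k) *: q)).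
  - by move=> p /flattenP[r /nseqP[-> _]]; apply: prps.
  - by move=> p /flattenP[r /nseqP[-> _]]; apply: primf.
  have -> : \prod_(p <- flatten (nseq k ps)) p = (\prod_(p <- ps) p) ^+ k.
    elim: (k) => [|i IHi]; first by rewrite big_nil expr0.
    by rewrite /= big_cat /= IHi exprS.
  rewrite mul_polyC scalerA mulrC -exprMn -E exprMn -scalerA Eg.
  by rewrite -!mul_polyC; ring.
have [szf1|szf1] := leqP (size f) 1.
  have Ef := size1_polyC szf1; rewrite Ef in f0 *; rewrite polyC_eq0 in f0.
  by have [qs facf] := facS _ f0; exists (map polyC qs); apply: factorization_upto_polyC.
(* If [f] is irreducible over the fraction field it is prime there, and [cancel] brings this back to
   the localization. *)
have [irr|nirr] := pselect (forall q : {poly D}, size q != 1%N -> dvdp q f -> Pdiv.Idomain.eqp q f).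
  exists [:: f]; apply: factorization_upto_prime; split=> // g h [_ [e [[u Su ->] Ee]]].
  have /irreducible_dvd_mul[|dvdg|dvdh] : dvdp f (g * h).
  - by apply/Pdiv.Idomain.dvdpP; exists (u, e); rewrite /= ?S0 // -mul_polyC Ee mulrC.
  - by split.
  - by left; apply: cancel.
  - by right; apply: cancel.
have [q [szq dvdq neqq]] : exists q : {poly D}, [/\ size q != 1%N, dvdp q f & ~~ Pdiv.Idomain.eqp q f].
  apply: contrapT => nq; apply: nirr => q szq dvdq; apply: contrapT => /negP neqq.
  by apply: nq; exists q.
have [[c e] /= c0 Ece] := Pdiv.Idomain.dvdpP _ _ dvdq.
have q0 : q != 0 by apply: contraNneq f0 => q0; rewrite q0 Pdiv.Idomain.dvd0p in dvdq.
have e0 : e != 0.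
  by apply: contraNneq f0 => e0; move/eqP: Ece; rewrite e0 mul0r -mul_polyC mulf_eq0 polyC_eq0 (negPf c0).
have ltqf : (size q < size f)%N.
  by rewrite ltn_neqAle Pdiv.Idomain.dvdp_size_eqp // neqq Pdiv.Idomain.dvdp_leq.
have ltef : (size e < size f)%N.
  have : size f = (size e + size q).-1 by rewrite -size_mul // -Ece size_scale.
  by move: szq; rewrite -size_poly_gt0 in q0; case: (size q) q0 => [|[|i]] // _ _ ->; rewrite !addnS /= ltnS leq_addr.
have [cs [prcs [u [v [Su Sv Ec]]]]] := facS _ c0.
(* The primes of [c] are distributed over [e] and [q], both of smaller degree than [f]. *)
have [|w [e' [q' [Sw Ew sze szq']]]] := @gauss_split cs (v *: f) (u *: e) q prcs.
  by rewrite scalerA mulrC -Ec -scalerA Ece -!mul_polyC mulrA.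
have nz (h h' : {poly D}) : size h' = size h -> h != 0 -> h' != 0.
  by move=> szh; rewrite -!size_poly_eq0 szh.
rewrite size_scale ?S0 // in sze.
have [||es face] := IHn e'; [by rewrite sze (leq_trans ltef) | exact: nz e0 |].
have [||qs facq] := IHn q'; [by rewrite szq' (leq_trans ltqf) | exact: nz q0 |].
exists (es ++ qs); apply: (factorization_upto_lift (SM _ _ Sw Sv)).
by rewrite -scalerA Ew; apply: factorization_upto_mul.
Qed.
End Factorial.

(** * Noetherian normal domains *)

Definition divs (D : comNzRingType) (d x : D) : Prop := exists y, x = d * y.

Lemma divs_ideal (D : comNzRingType) (d z : D) : is_ideal (fun x => divs d (x * z)).
Proof.
split; first by exists 0; rewrite mul0r mulr0.
- by move=> x y [a Ea] [b Eb]; exists (a + b); rewrite mulrDl mulrDr Ea Eb.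
- by move=> r x [a Ea]; exists (r * a); rewrite -mulrA Ea mulrCA.
Qed.

(** The union of the chain is an ideal, and its finitely many generators already lie in one
    [I k]. *)
Lemma noetherian_acc (R : comNzRingType) (I : nat -> R -> Prop) :
  noetherian R -> (forall k, is_ideal (I k)) -> (forall k x, I k x -> I k.+1 x) ->
  exists k, forall x, I k.+1 x -> I k x.
Proof.
move=> noethR idI mono.
have monoD k m x : I k x -> I (k + m)%N x.
  by move=> Ikx; elim: m => [|m IHm]; rewrite ?addn0 // addnS; apply: mono.
have [|s Us] := noethR (fun x => exists k, I k x).
  split; first by exists 0; case: (idI 0).
  - move=> x y [k Ix] [m Iy]; exists (k + m)%N.
    have [_ ID _] := idI (k + m)%N; apply: ID; first exact: monoD.
    by rewrite addnC; apply: monoD.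
  - by move=> r x [k Ix]; exists k; have [_ _ IM] := idI k; apply: IM.
have [k Ik] : exists k, forall i, (i < size s)%N -> I k s`_i.
  have: forall i, (i < size s)%N -> exists k, I k s`_i.
    move=> i lti; apply/Us; exists (fun j => (j == i)%:R).
    rewrite (bigD1 (Ordinal lti)) //= eqxx mul1r big1 ?addr0 // => j.
    by rewrite -val_eqE /= => /negPf ->; rewrite mul0r.
  elim: (size s) => [|m IHm] H; first by exists 0.
  have [|k Hk] := IHm; first by move=> i ltim; apply: H; apply: ltnW.
  have [k' Hk'] := H m (ltnSn m); exists (k + k')%N => i; rewrite ltnS leq_eqVlt.
  by case/orP=> [/eqP -> | /Hk]; [rewrite addnC; apply: monoD | apply: monoD].
exists k => x Ix; have /Us[c ->] : exists k, I k x by exists k.+1.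
by apply: ideal_sum => // i _ _; have [_ _ IM] := idI k; apply: IM; apply: Ik.
Qed.

Lemma noetherian_max (R : comNzRingType) (T : Type) (F : T -> R -> Prop) (t0 : T) :
  noetherian R -> (forall t, is_ideal (F t)) ->
  exists t, forall t', (forall x, F t x -> F t' x) -> forall x, F t' x -> F t x.
Proof.
move=> noethR idF; apply: contrapT => /forallNP nmax.
have /choice[next nextP] : forall t, exists t',
    (forall x, F t x -> F t' x) /\ ~ (forall x, F t' x -> F t x).
  by move=> t; have /existsNP[t' /not_implyP[le nle]] := nmax t; exists t'.
have [||k] := @noetherian_acc R (fun k => F (iter k next t0)) noethR.
- by move=> k; apply: idF.
- by move=> k x; have [le _] := nextP (iter k next t0); apply: le.
- by have [_] := nextP (iter k next t0).
Qed.

(** With [w = z / d] the hypotheses give [y i = d * w ^+ i], so the relation makes [w] integral over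
    [R], and normality puts it into [R]. *)
Lemma integral_power_relation (R : idomainType) (d z : R) (y c : nat -> R) k :
  normal_domain R -> d != 0 -> y 0%N = d -> (forall i, z * y i = d * y i.+1) ->
  y k = \sum_(i < k) c i * y i -> divs d z.
Proof.
move=> normR d0 y0 yS Ek; pose w := FracField.tofrac z / FracField.tofrac d.
have td0 : FracField.tofrac d != 0 by rewrite tofrac_eq0.
have dw : FracField.tofrac d * w = FracField.tofrac z by rewrite mulrC divfK.
have yE i : FracField.tofrac (y i) = FracField.tofrac d * w ^+ i.
  elim: i => [|i IHi]; first by rewrite expr0 mulr1 y0.
  apply: (mulfI td0); rewrite -tofracM -yS tofracM IHi exprS -dw.
  by rewrite -mulrA (mulrCA w).
have [|r wr] := normR w.
  exists ('X^k - \poly_(i < k) c i); split.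
    by rewrite monicE lead_coefDl ?lead_coefXn // size_polyN size_polyXn ltnS size_poly.
  rewrite /root rmorphB /= map_polyXn hornerD hornerN hornerXn poly_def rmorph_sum /=.
  rewrite horner_sum; apply/eqP; apply: (mulfI td0).
  rewrite mulr0 mulrBr -yE Ek rmorph_sum /= mulr_sumr -sumrB big1 // => i _.
  by rewrite map_polyZ /= map_polyXn hornerZ hornerXn rmorphM /= yE mulrCA subrr.
by exists r; apply/eqP; rewrite -tofrac_eq tofracM -wr dw.
Qed.

(* The prime [p] is associated to [d] and, thanks to normality, the localization
   at [p] is a discrete valuation ring with uniformizer [q]. *)
Lemma local_uniformizer (R : idomainType) (d z : R) :
  noetherian R -> normal_domain R -> d != 0 -> ~ divs d z ->
  exists (p : R -> Prop) (y q u : R),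
    [/\ prime_pred p, (forall x, p x <-> divs d (x * (y * z))),
        ~ divs d (y * z), [/\ p q, ~ p u & q != 0] & forall x, p x -> exists x', u * x = q * x'].
Proof.
move=> noethR normR d0 ndz.
pose T := {y : R | ~ divs d (y * z)}.
have nd1 : ~ divs d (1 * z) by rewrite mul1r.
(* Among the annihilators of the nonzero multiples [y * z] modulo [d], a maximal one is prime. *)
have [|[y ndy] /= maxy] :=
    @noetherian_max R T (fun t x => divs d (x * (sval t * z))) (exist _ 1 nd1) noethR.
  by move=> t; apply: divs_ideal.
pose p x := divs d (x * (y * z)).
have idp : is_ideal p by apply: divs_ideal.
have prp : prime_pred p.
  split=> // a b pab; apply: contrapT => /not_orP[npa npb]; apply: npb.
  have nday : ~ divs d (a * y * z) by rewrite -mulrA.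
  have := maxy (exist _ (a * y) nday); rewrite /= /p; apply.
    by move=> x [e Ee]; exists (a * e); rewrite (mulrCA d) -Ee; ring.
  by move: pab => [e Ee]; exists e; rewrite -Ee; ring.
have pd : p d by exists (y * z).
(* If multiplication by [y * z / d] mapped [p] into itself, the ascending chain condition would make
   [y * z / d] integral, hence an element of [R], against [ndy]. So some [q] in [p] is sent to an
   element [u] outside [p], and this [q] is the uniformizer. *)
have [Q|nQ] := pselect (forall q, p q -> exists u, q * (y * z) = d * u /\ p u).
  case: ndy; have /choice[next nextP] : forall x, exists x', p x -> y * z * x = d * x' /\ p x'.
    move=> x; have [px|npx] := pselect (p x); last by exists 0.
    by have [u [Eu pu]] := Q x px; exists u; rewrite mulrC.
  (* The elements [v i] are [d] times the powers of [y * z / d]; their spans [I k] form the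
     chain. *)
  pose v i := iter i next d.
  have pv i : p (v i) by elim: i => //= i IHi; have [] := nextP _ IHi.
  pose I k x := exists c : nat -> R, x = \sum_(i < k) c i * v i.
  have idI k : is_ideal (I k).
    split; first by exists (fun=> 0); rewrite big1 // => i _; rewrite mul0r.
    - move=> _ _ [c ->] [c' ->]; exists (fun i => c i + c' i).
      by rewrite -big_split; apply: eq_bigr => i _; rewrite mulrDl.
    - move=> r _ [c ->]; exists (fun i => r * c i).
      by rewrite mulr_sumr; apply: eq_bigr => i _; rewrite mulrA.
  have [|k stab] := noetherian_acc noethR idI.
    move=> k _ [c ->]; exists (fun i => if (i < k)%N then c i else 0).
    rewrite big_ord_recr /= ltnn mul0r addr0.
    by apply: eq_bigr => i _; rewrite ltn_ord.
  have [|c Ec] := stab (v k).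
    exists (fun i => (i == k)%:R); rewrite big_ord_recr /= eqxx mul1r big1 ?add0r // => i _.
    by rewrite ltn_eqF ?mul0r.
  apply: (@integral_power_relation R d (y * z) v c k) => // i.
  by have [] := nextP _ (pv i).
have [q [u [pq Eu npu]]] : exists q u, [/\ p q, q * (y * z) = d * u & ~ p u].
  apply: contrapT => nq; apply: nQ => q pq; have [u Eu] := pq; exists u; split=> //.
  by apply: contrapT => npu; apply: nq; exists q, u.
exists p, y, q, u; split=> //.
  split=> //; apply/eqP => q0; apply: npu.
  move: Eu; rewrite q0 mul0r => /esym/eqP; rewrite mulf_eq0 (negPf d0) /= => /eqP ->.
  by case: idp.
move=> x [x' Ex]; exists x'; apply: (mulfI d0).
transitivity (q * (y * z) * x); first by rewrite Eu; ring.
by transitivity (q * (x * (y * z))); [ring | rewrite Ex; ring].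
Qed.

(** The ideals of all [y] such that [x] divides [q ^+ k * y] locally at [p] ascend with [k]. Once
    they are stable, one more factor [q] in [x] would put a product of two elements outside [p] into
    [p]. *)
Lemma uniformizer_order_bounded (R : idomainType) (p : R -> Prop) (q x : R) :
  noetherian R -> prime_pred p -> p q -> ~ p 1 -> q != 0 -> x != 0 ->
  exists k, forall s x', ~ p s -> s * x != q ^+ k * x'.
Proof.
move=> noethR [[p0 pD pM] prp] pq np1 q0 x0.
pose I k y := exists s e, ~ p s /\ s * (q ^+ k * y) = x * e.
have idI k : is_ideal (I k).
  split; first by exists 1, 0; split=> //; rewrite !mulr0.
  - move=> y z [s [e [ns E]]] [t [f [nt E']]]; exists (s * t), (t * e + s * f).
    split; first by case/prp.
    transitivity (t * (s * (q ^+ k * y)) + s * (t * (q ^+ k * z))); first by ring.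
    by rewrite E E'; ring.
  - by move=> r y [s [e [ns E]]]; exists s, (r * e); split=> //;
      transitivity (r * (s * (q ^+ k * y))); [ring | rewrite E; ring].
have [|k stab] := noetherian_acc noethR idI.
  by move=> k y [s [e [ns E]]]; exists s, (q * e); split=> //;
    transitivity (q * (s * (q ^+ k * y))); [rewrite exprS; ring | rewrite E; ring].
exists k.+1 => s x' ns; apply/eqP => E.
have [|t [e [nt E']]] := stab x'.
  by exists 1, s; split=> //; rewrite mul1r -E mulrC.
have /prp[//|//] : p (s * t).
have -> : s * t = e * q.
  apply: (mulIf x0); transitivity (t * (s * x)); first by ring.
  by rewrite E; transitivity (q * (t * (q ^+ k * x'))); [rewrite exprS; ring | rewrite E'; ring].
exact: pM.
Qed.

(** * Contents of polynomials in several variables *)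

Lemma mpolyC_zmod (R : idomainType) n : zmod_morphism (@mpolyC R n).
Proof. by elim: n => //= n IHn x y; rewrite IHn polyCB. Qed.

Lemma mpolyC_monoid (R : idomainType) n : monoid_morphism (@mpolyC R n).
Proof.
elim: n => [|n [IH1 IHM]] //=; split; first by rewrite IH1.
by move=> x y; rewrite IHM polyCM.
Qed.

HB.instance Definition _ (R : idomainType) n :=
  GRing.isZmodMorphism.Build R (mpoly R n) (@mpolyC R n) (@mpolyC_zmod R n).
HB.instance Definition _ (R : idomainType) n :=
  GRing.isMonoidMorphism.Build R (mpoly R n) (@mpolyC R n) (@mpolyC_monoid R n).

Lemma mpolyC_eq0 (R : idomainType) n (r : R) : (mpolyC n r == 0) = (r == 0).
Proof. by elim: n => //= n <-; rewrite polyC_eq0. Qed.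

(** Setting all variables to zero; this pushes relations among elements of [A] down to [R]. *)
Lemma mpoly_augmentation (R : idomainType) n :
  exists eps : {rmorphism mpoly R n -> R}, forall r, eps (mpolyC n r) = r.
Proof.
elim: n => [|n [eps epsC]]; first by exists idfun.
by exists (eps \o horner_eval 0 : {rmorphism _ -> _}) => r; rewrite /= /horner_eval hornerC epsC.
Qed.

(** The recursion follows [constS], so that Gauss's theorem can be iterated over the variables. *)
Fixpoint nzconst (R : idomainType) n : mpoly R n -> Prop :=
  match n return mpoly R n -> Prop with
  | 0 => fun x => x != 0
  | n'.+1 => constS (@nzconst R n')
  end.

Lemma nzconstP (R : idomainType) n (f : mpoly R n) :
  nzconst f <-> exists2 r, r != 0 & f = mpolyC n r.
Proof.
elim: n f => [|n IHn] /= f; first by split=> [f0|[r r0 ->] //]; exists f.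
split=> [[s /IHn[r r0 ->] ->]|[r r0 ->]]; first by exists r.
by exists (mpolyC n r) => //; apply/IHn; exists r.
Qed.

Lemma nzconst_mult (R : idomainType) n : mult_set (@nzconst R n).
Proof.
elim: n => [|n IHn] /=; last exact: mult_constS.
by split=> // [|x y x0 y0]; [exact: oner_neq0 | exact: mulf_neq0].
Qed.

Lemma mpoly_factorial (R : idomainType) n : factorial_upto (@nzconst R n).
Proof.
elim: n => [|n IHn] /=; last exact: factorial_upto_poly (nzconst_mult R n) IHn.
move=> x x0; exists [::]; split=> //; exists 1, x.
by rewrite big_nil mulr1 mul1r /= oner_neq0.
Qed.

Fixpoint mterms (R : idomainType) n : mpoly R n -> seq (R * mpoly R n) :=
  match n return mpoly R n -> seq (R * mpoly R n) with
  | 0 => fun f => [:: (f, 1)]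
  | n'.+1 => fun f =>
      flatten [seq [seq (t.1, t.2%:P * 'X^i) | t <- mterms f`_i] | i <- iota 0 (size f)]
  end.

Lemma mtermsE (R : idomainType) n (f : mpoly R n) :
  f = \sum_(t <- mterms f) mpolyC n t.1 * t.2.
Proof.
have aux (D : idomainType) (c m : D) i : (c * m)%:P * 'X^i = c%:P * (m%:P * 'X^i).
  by rewrite polyCM mulrA.
elim: n f => [|n IHn] f /=; first by rewrite big_seq1 mulr1.
rewrite big_flatten /= big_map -[f in LHS]coefK poly_def.
rewrite -(big_mkord predT (fun i => f`_i *: 'X^i)) /index_iota subn0; apply: eq_bigr => i _.
rewrite big_map /= [in LHS](IHn f`_i) -mul_polyC raddf_sum mulr_suml.
by apply: eq_bigr => t _; apply: aux.
Qed.

Fixpoint mcoefs_in (R : idomainType) (Q : R -> Prop) n : mpoly R n -> Prop :=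
  match n return mpoly R n -> Prop with
  | 0 => Q
  | n'.+1 => fun f => forall k, mcoefs_in Q f`_k
  end.

Lemma mcoefs_in0 (R : idomainType) (Q : R -> Prop) n : Q 0 -> mcoefs_in Q (0 : mpoly R n).
Proof. by move=> Q0; elim: n => //= n IHn k; rewrite coef0. Qed.

(** The hypothesis [Q 0] covers the coefficients beyond the size, which [mterms] does not list. *)
Lemma mcoefs_inP (R : idomainType) (Q : R -> Prop) n (f : mpoly R n) :
  Q 0 -> mcoefs_in Q f <-> forall t, t \in mterms f -> Q t.1.
Proof.
move=> Q0; elim: n f => [|n IHn] f /=.
  by split=> [Qf t|Qt]; [rewrite inE => /eqP -> | apply: (Qt (f, 1)); rewrite mem_head].
split=> [Qf t /flattenP[_ /mapP[i _ ->] /mapP[t' t'i ->]] | Qt k].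
  by have /IHn Qi := Qf i; apply: Qi t'i.
have [lek|ltk] := leqP (size f) k; first by rewrite nth_default //; apply: mcoefs_in0.
apply/IHn => t tk; apply: (Qt (t.1, t.2%:P * 'X^k)).
apply/flattenP; exists [seq (t.1, t.2%:P * 'X^k) | t <- mterms f`_k].
  by apply/mapP; exists k; rewrite // mem_iota.
by apply/mapP; exists t.
Qed.

Lemma mcoefs_in_scale (R : idomainType) (Q : R -> Prop) n r (f : mpoly R n) :
  mcoefs_in Q (mpolyC n r * f) <-> mcoefs_in (fun x => Q (r * x)) f.
Proof.
by elim: n f => //= n IHn f; split=> H k; have := H k; rewrite coefCM => /IHn.
Qed.

Lemma mcoefs_inC (R : idomainType) (Q : R -> Prop) n r : mcoefs_in Q (mpolyC n r) -> Q r.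
Proof. by elim: n => //= n IHn Qr; apply: IHn; have := Qr 0%N; rewrite coefC. Qed.

Lemma mcoefs_in_prime (R : idomainType) (p : R -> Prop) n :
  prime_pred p -> prime_pred (@mcoefs_in R p n).
Proof. by move=> prp; elim: n => //= n IHn; apply: prime_poly. Qed.

Lemma divs_polyC (D : idomainType) (d : D) (f : {poly D}) :
  divs d%:P f <-> forall k, divs d f`_k.
Proof.
split=> [[g ->] k|]; first by exists g`_k; rewrite coefCM.
elim/poly_ind: f => [_|f c IHf dvdf]; first by exists 0; rewrite mulr0.
have [k|g ->] := IHf; first by have := dvdf k.+1; rewrite coefD coefMX coefC /= addr0.
have [e ->] : divs d c by have := dvdf 0%N; rewrite coefD coefMX coefC /= add0r.
by exists (g * 'X + e%:P); ring.
Qed.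

Lemma divs_mpolyC (R : idomainType) n (d : R) (f : mpoly R n) :
  divs (mpolyC n d) f <-> mcoefs_in (divs d) f.
Proof.
elim: n f => //= n IHn f.
by split=> [/divs_polyC H k | H]; [apply/IHn | apply/divs_polyC => k; apply/IHn].
Qed.

Lemma divs_mterms (R : idomainType) n (d r : R) (f : mpoly R n) :
  divs (mpolyC n d) (mpolyC n r * f) <-> forall t, t \in mterms f -> divs d (r * t.1).
Proof.
have d0 : divs d (r * 0) by exists 0; rewrite !mulr0.
split=> [/divs_mpolyC/mcoefs_in_scale/mcoefs_inP | dvd]; first by apply.
by apply/divs_mpolyC/mcoefs_in_scale/mcoefs_inP.
Qed.

(** The Gauss valuation at [p]: [k] is the largest power of [q] that can be extracted from [f] with
    denominators outside [p]. Any nonzero coefficient of [f] bounds it. *)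
Lemma mpoly_order (R : idomainType) (p : R -> Prop) (q u : R) n (f : mpoly R n) :
  noetherian R -> prime_pred p -> ~ p u -> q != 0 -> p q -> ~ p 1 ->
  (forall x, p x -> exists x', u * x = q * x') -> f != 0 ->
  exists k s f', [/\ ~ p s, mpolyC n s * f = mpolyC n (q ^+ k) * f' & ~ mcoefs_in p f'].
Proof.
move=> noethR prp npu q0 pq np1 unif f0.
have p0 : p 0 by case: prp => [[]].
have [t tf t0] : exists2 t, t \in mterms f & t.1 != 0.
  apply: contrapT => nt; move/eqP: f0; apply; rewrite (mtermsE f) big_seq big1 // => t tf.
  have [->|t0] := eqVneq t.1 0; first by rewrite rmorph0 mul0r.
  by case: nt; exists t.
have [m bound] := uniformizer_order_bounded noethR prp pq np1 q0 t0.
pose P k := `[< exists s f', ~ p s /\ mpolyC n s * f = mpolyC n (q ^+ k) * f' >].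
have exP : exists k, P k.
  by exists 0%N; apply/asboolP; exists 1, f; rewrite expr0 !rmorph1.
have bndP k : P k -> (k <= m)%N.
  move=> /asboolP[s [f' [ns E]]]; rewrite leqNgt; apply/negP => /ltnW lemk.
  have /divs_mterms/(_ t tf)[x Ex] : divs (mpolyC n (q ^+ k)) (mpolyC n s * f) by exists f'.
  have /eqP[] := bound s (q ^+ (k - m) * x) ns.
  by rewrite Ex mulrA -exprD subnKC.
case: (ex_maxnP exP bndP) => k /asboolP[s [f' [ns E]]] maxk.
exists k, s, f'; split=> // pf'.
(* If all coefficients of [f'] were in [p], the uniformizer would extract one more factor [q]. *)
have /divs_mterms[g Eg] : forall t, t \in mterms f' -> divs q (u * t.1).
  by move=> t' /((mcoefs_inP f' p0).1 pf')/unif[x ->]; exists x.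
have := maxk k.+1; rewrite ltnn => /(_ _)/negP[]; last by [].
apply/asboolP; exists (u * s), g; split; first by case: prp => _ pr /pr[].
rewrite rmorphM -mulrA E exprSr [in RHS]rmorphM -[in RHS]mulrA -Eg; ring.
Qed.

(* Gauss's lemma over a Krull domain, checked at the localizations that are discrete
   valuation rings. *)
Lemma content_dvd (R : idomainType) n (d : R) (f g : mpoly R n) :
  noetherian R -> normal_domain R -> d != 0 -> divs (mpolyC n d) (f * g) ->
  forall t, t \in mterms f -> divs (mpolyC n d) (mpolyC n t.1 * g).
Proof.
move=> noethR normR d0 [h Eh] t tf; apply/divs_mterms => t' t'g.
apply: contrapT => ndvd.
have [p [y [q [u [prp pE ndy [pq npu q0] unif]]]]] := local_uniformizer noethR normR d0 ndvd.
have [[p0 pD pM] pr] := prp.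
have np1 : ~ p 1 by move/pE; rewrite mul1r.
have nz0 r : r = 0 -> divs d (y * r) by move=> ->; exists 0; rewrite !mulr0.
have zero_case (e : mpoly R n) (v : R * mpoly R n) : v \in mterms e -> e = 0 -> v.1 = 0.
  move=> ve e0; have /divs_mterms/(_ v ve)[x] : divs (mpolyC n 0) (mpolyC n 1 * e).
    by exists 0; rewrite e0 !mulr0.
  by rewrite mul1r mul0r.
have f0 : f != 0.
  by apply/eqP => f0; apply/ndy/nz0; rewrite (zero_case _ _ tf f0) mul0r.
have g0 : g != 0.
  by apply/eqP => g0; apply/ndy/nz0; rewrite (zero_case _ _ t'g g0) mulr0.
have order m (e : mpoly R m) := mpoly_order noethR prp npu q0 pq np1 unif (f := e).
have [a [s [f' [ns Ef nf']]]] := order n f f0.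
have [b [s' [g' [ns' Eg ng']]]] := order n g g0.
have [c [v [d' [nv Ed nd']]]] := order 0%N d d0; rewrite /= in Ed nd'.
have [_ prn] := @mcoefs_in_prime R p n prp.
have Efg : mpolyC n (s * s') * (f * g) = mpolyC n (q ^+ (a + b)) * (f' * g').
  rewrite exprD !rmorphM.
  transitivity ((mpolyC n s * f) * (mpolyC n s' * g)); first by ring.
  by rewrite Ef Eg; ring.
(* Here [a], [b] and [c] are the orders of [f], [g] and [d] at [p]. If [a + b < c], a factor [q]
   remains in [v * f' * g'], though [p] is prime on coefficients; otherwise [d' * (s * s')] lands in
   [p], though none of its factors does. *)
have [ltab|leca] := ltnP (a + b) c.
  have : mcoefs_in p (mpolyC n v * (f' * g')).
    have -> : mpolyC n v * (f' * g') = mpolyC n (q ^+ (c - (a + b))) * (mpolyC n (s * s' * d') * h).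
      apply: (mulfI (_ : mpolyC n (q ^+ (a + b)) != 0)).
        by rewrite mpolyC_eq0 expf_neq0.
      rewrite mulrCA -Efg Eh [in RHS]mulrA -rmorphM -exprD subnKC ?(ltnW ltab) //.
      transitivity (mpolyC n (s * s') * mpolyC n (v * d) * h); first by rewrite !rmorphM; ring.
      by rewrite Ed !rmorphM; ring.
    apply/mcoefs_in_scale/mcoefs_inP; first by rewrite mulr0.
    by move=> w _; rewrite -(subnSK ltab) exprSr mulrAC; apply: pM.
  by case/prn=> [/mcoefs_inC//|/prn[]].
suff /pr[|/pr[]] : p (d' * (s * s')) by [].
have Eft : divs (mpolyC n (q ^+ a)) (mpolyC n s * f) by exists f'.
have Egt : divs (mpolyC n (q ^+ b)) (mpolyC n s' * g) by exists g'.
have /divs_mterms/(_ t tf)[x Ex] := Eft; have /divs_mterms/(_ t' t'g)[x' Ex'] := Egt.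
apply/pE; exists (v * y * x * x' * q ^+ (a + b - c)).
transitivity (d' * y * (s * t.1) * (s' * t'.1)); first by ring.
rewrite Ex Ex'; transitivity (q ^+ (a + b) * d' * y * x * x'); first by rewrite exprD; ring.
transitivity (v * d * y * x * x' * q ^+ (a + b - c)); last by ring.
by rewrite Ed -[in LHS](subnKC leca) exprD; ring.
Qed.

(** * Exponential maps and their invariants *)

(** Leading coefficients in [U] are compared in axiom (ii): substituting [V + U], monic of degree
    one in [U], leaves the leading coefficient unchanged, while [map_poly phi] applies [phi] to
    it. *)
Lemma exp_map_lead_invariant (B : idomainType) (A : B -> Prop)
    (phi : {rmorphism B -> {poly B}}) b :
  is_exp_map A phi -> invariants phi (lead_coef (phi b)).
Proof.
move=> [_ phi0 phiD].
have injphi : injective phi by move=> x y E; rewrite -(phi0 x) E phi0.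
have := congr1 lead_coef (phiD b).
rewrite lead_coef_map_inj ?rmorph0 // => E; rewrite /invariants E.
rewrite lead_coef_comp ?size_XaddC // lead_coefXaddC expr1n mulr1.
by rewrite lead_coef_map_inj ?rmorph0 //; apply: polyC_inj.
Qed.

Section ExpMap.
Variables (B : idomainType) (A : B -> Prop) (phi : {rmorphism B -> {poly B}}).
Hypothesis expphi : is_exp_map A phi.
Hypothesis invA : forall b, A b <-> invariants phi b.

Lemma invariants_mul x y : A x -> A y -> A (x * y).
Proof. by rewrite !invA /invariants => Ax Ay; rewrite rmorphM Ax Ay polyCM. Qed.

Lemma invariants_sub x y : A x -> A y -> A (x - y).
Proof. by rewrite !invA /invariants => Ax Ay; rewrite rmorphB Ax Ay polyCB. Qed.

Lemma invariants1 : A 1.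
Proof. by apply/invA; rewrite /invariants rmorph1. Qed.

Lemma invariants0 : A 0.
Proof. by apply/invA; rewrite /invariants !rmorph0. Qed.

Lemma invariants_sum n (F : 'I_n -> B) : (forall i, A (F i)) -> A (\sum_(i < n) F i).
Proof.
move=> AF; apply: (big_ind A) => //; first exact: invariants0.
move=> x y Ax Ay; rewrite -[y]opprK; apply: invariants_sub => //.
by rewrite -sub0r; apply: invariants_sub => //; apply: invariants0.
Qed.

(* The elements of degree less than [N] in [U] have rank at most [N] over [A],
   because leading coefficients are invariant. *)
Lemma invariants_dependent N k (b : 'I_k -> B) :
  (N < k)%N -> (forall i, (size (phi (b i)) <= N)%N) ->
  exists a : 'I_k -> B,
    [/\ forall i, A (a i), exists i, a i != 0 & \sum_(i < k) a i * b i = 0].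
Proof.
have [_ phi0 _] := expphi.
elim: N k b => [|N IHN] k b ltNk szb.
  exists (fun=> 1); split; first by move=> _; apply: invariants1.
    by exists (Ordinal ltNk); apply: oner_neq0.
  rewrite big1 // => i _; have := szb i.
  by rewrite leqn0 size_poly_eq0 => /eqP E; rewrite mul1r -(phi0 (b i)) E horner0.
have [[i0 szi0]|all_lt] := pselect (exists i, size (phi (b i)) = N.+1); last first.
  apply: IHN => [|i]; first exact: ltnW.
  have := szb i; rewrite leq_eqVlt => /orP[/eqP szi|//].
  by case: all_lt; exists i.
case: k b ltNk szb i0 szi0 => [|k] b; [by [] | rewrite ltnS => ltNk szb i0 szi0].
pose c i := (phi (b i))`_N.
(* The coefficient at [N] is the leading one or zero, invariant in both cases. *)
have Ac i : A (c i).
  have := szb i; rewrite leq_eqVlt => /orP[/eqP szi|szi].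
    have -> : c i = lead_coef (phi (b i)) by rewrite lead_coefE szi.
    by apply/invA/(exp_map_lead_invariant _ expphi).
  by rewrite /c nth_default //; apply: invariants0.
have c0 : c i0 != 0.
  have -> : c i0 = lead_coef (phi (b i0)) by rewrite lead_coefE szi0.
  by rewrite lead_coef_eq0 -size_poly_eq0 szi0.
(* These combinations with [b i0] have no coefficient at [N], so the induction hypothesis applies to
   the remaining [k] elements. *)
have [||a [Aa [j aj] Ea]] := IHN k (fun j => c i0 * b (lift i0 j) - c (lift i0 j) * b i0) => //.
  move=> l; apply/leq_sizeP => m; rewrite rmorphB !rmorphM /=.
  have phic i : phi (c i) = (c i)%:P by apply/invA.
  rewrite !phic coefB !coefCM leq_eqVlt => /orP[/eqP <-|ltNm].
    by rewrite mulrC subrr.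
  by rewrite !nth_default ?mulr0 ?subrr //; apply: leq_trans ltNm.
exists (fun i => if unlift i0 i is Some j then a j * c i0 else - \sum_j a j * c (lift i0 j)).
split.
- move=> i; case: (unlift i0 i) => [l|]; first exact: invariants_mul.
  rewrite -sub0r; apply: invariants_sub; first exact: invariants0.
  by apply: invariants_sum => l; apply: invariants_mul.
- by exists (lift i0 j); rewrite liftK mulf_neq0.
rewrite (bigD1_ord i0) //= unlift_none mulNr -[RHS]Ea mulr_suml -sumrN -big_split /=.
by apply: eq_bigr => l _; rewrite liftK; ring.
Qed.

(** With [D] the sum of the degrees of [phi F] and [phi h], the [(D + 2)^2] products of powers with
    exponents at most [D + 1] have degree at most [D * (D + 1)] in [U], so they outnumber the rank
    available over [A]. *)
Lemma algebraic_dependence F h : exists s (a : nat -> nat -> B),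
  [/\ forall i j, A (a i j), exists i j, [/\ (i < s)%N, (j < s)%N & a i j != 0] &
      \sum_(i < s) F ^+ i * \sum_(j < s) a i j * h ^+ j = 0].
Proof.
have [_ phi0 _] := expphi.
pose dF := (size (phi F)).-1; pose dh := (size (phi h)).-1; pose D := (dF + dh)%N.
pose s := D.+2; pose T := ('I_s * 'I_s)%type.
pose b (i : 'I_#|{: T}|) := F ^+ (enum_val i).1 * h ^+ (enum_val i).2.
have [||a [Aa [i0 ai0] Ea]] := @invariants_dependent (D.+1 * D).+1 _ b.
- by rewrite card_prod !card_ord /s; lia.
- move=> i; rewrite /b; case: (enum_val i) => j k /=.
  rewrite rmorphM !rmorphXn.
  apply: leq_trans (size_polyMleq _ _) _.
  have := size_poly_exp_leq (phi F) j; have := size_poly_exp_leq (phi h) k.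
  rewrite -/dF -/dh; have := ltn_ord j; have := ltn_ord k; rewrite !ltnS => lek lej leh leF.
  have leDj : (dF * j <= dF * D.+1)%N by rewrite leq_mul2l lej orbT.
  have leDk : (dh * k <= dh * D.+1)%N by rewrite leq_mul2l lek orbT.
  have ED : (D.+1 * D = dF * D.+1 + dh * D.+1)%N by rewrite -mulnDl mulnC.
  have aux (x y u v u' v' : nat) : (x <= u.+1 -> y <= v.+1 -> u <= u' -> v <= v' ->
      (x + y).-1 <= (u' + v').+1)%N by lia.
  by rewrite ED; apply: aux leF leh leDj leDk.
exists s, (fun i j => a (enum_rank (inord i : 'I_s, inord j : 'I_s))); split=> //.
  exists (enum_val i0).1, (enum_val i0).2; split=> //.
  by rewrite !inord_val -surjective_pairing enum_valK.
rewrite -[RHS]Ea (reindex (@enum_rank T)) /=; last first.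
  by exists enum_val => x _; [apply: enum_rankK | apply: enum_valK].
transitivity (\sum_(i < s) \sum_(j < s) a (enum_rank (i, j)) * b (enum_rank (i, j)));
  last by rewrite pair_bigA; apply: eq_bigr => -[].
apply: eq_bigr => i _; rewrite mulr_sumr; apply: eq_bigr => j _.
by rewrite /b enum_rankK !inord_val /=; ring.
Qed.

Variables (pi : {rmorphism B -> B}) (S : B -> Prop).
Hypothesis multS : mult_set S.
Hypothesis piA : forall a, A a -> pi a = a.
Hypothesis SA : forall s, S s -> A s.

(** If [F] did not divide [h], the two would be algebraically independent over [A]. *)
Lemma prime_upto_kernel_dvd F h : prime_upto S F -> pi F = 0 -> pi h = 0 -> dvd_upto S F h.
Proof.
case: multS => S1 SM S0 [F0 prF] piF pih; apply: contrapT => ndvd.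
(* Applying [pi] kills [F] and [h] and leaves the constant term [a 0], which is therefore zero; the
   prime [F] then divides the sum with one factor [h] removed. *)
have inner m (a : nat -> B) : (forall j, A (a j)) ->
    dvd_upto S F (\sum_(j < m) a j * h ^+ j) -> forall j, (j < m)%N -> a j = 0.
  elim: m a => // m IHm a Aa; rewrite big_ord_recl /= mulr1.
  have -> : \sum_(j < m) a (bump 0 j) * h ^+ bump 0 j = h * \sum_(j < m) a j.+1 * h ^+ j.
    by rewrite mulr_sumr; apply: eq_bigr => j _; rewrite exprS mulrCA.
  move=> [s [e [Ss E]]].
  have a0 : a 0%N = 0.
    have /eqP := congr1 pi E; rewrite !rmorphM rmorphD rmorphM piF pih !mul0r addr0.
    by rewrite !piA ?mulf_eq0 ?(negPf (S0 _ Ss)) //=; [move/eqP | apply: SA].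
  have /prF[//|/(IHm (fun j => a j.+1) (fun j => Aa j.+1)) dvd] : dvd_upto S F (h * \sum_(j < m) a j.+1 * h ^+ j).
    by exists s, e; split=> //; rewrite -E a0 add0r.
  by case=> [//|j]; rewrite ltnS => ltj; apply: dvd.
have [s [a [Aa [i [j [lti ltj aij]]] Ea]]] := algebraic_dependence F h.
(* The part free of [F] is divisible by [F], hence has zero coefficients by [inner], and one factor
   [F] cancels from the rest. *)
have outer m (c : nat -> nat -> B) : (forall i j, A (c i j)) ->
    \sum_(i < m) F ^+ i * \sum_(j < s) c i j * h ^+ j = 0 ->
    forall i j, (i < m)%N -> (j < s)%N -> c i j = 0.
  elim: m c => // m IHm c Ac; rewrite big_ord_recl /= mul1r.
  have -> : \sum_(i < m) F ^+ bump 0 i * (\sum_(j < s) c (bump 0 i) j * h ^+ j) =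
      F * \sum_(i < m) F ^+ i * (\sum_(j < s) c i.+1 j * h ^+ j).
    by rewrite mulr_sumr; apply: eq_bigr => k _; rewrite exprS mulrA.
  move=> E; have c0 : forall k, (k < s)%N -> c 0%N k = 0.
    apply: inner => //; exists 1, (- \sum_(i < m) F ^+ i * (\sum_(j < s) c i.+1 j * h ^+ j)).
    by split=> //; rewrite mul1r mulrN; apply/eqP; rewrite -addr_eq0 E.
  case=> [k _|k l]; first exact: c0.
  rewrite ltnS; apply: (IHm (fun i => c i.+1)) => //.
  apply: (mulfI F0); rewrite mulr0; move: E.
  rewrite [X in X + _]big1 ?add0r // => x _.
  by rewrite c0 // mul0r.
by move/eqP: aij; apply; apply: outer Ea _ _ lti ltj.
Qed.
End ExpMap.

(** * The symmetric algebra structure *)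

Lemma rmorphism_of (B T : nzRingType) (g : B -> T) :
  zmod_morphism g -> monoid_morphism g -> exists h : {rmorphism B -> T}, h =1 g.
Proof.
move=> gZ gM.
pose gZm := GRing.isZmodMorphism.Build B T g gZ.
pose gMm := GRing.isMonoidMorphism.Build B T g gM.
by exists (HB.pack g gZm gMm : {rmorphism B -> T}).
Qed.

(* [E i] is division of [c i * (b - pi b)] by [F]: a twisted derivation that lowers
   the degree in [U] and drives all the inductions below. *)
Section SymmetricAlgebra.
Variables (R B : idomainType) (C : {rmorphism R -> B}) (eps : {rmorphism B -> R}).
Hypothesis C_eq0 : forall r, (C r == 0) = (r == 0).
Hypothesis epsC : forall r, eps (C r) = r.
Variables (A : B -> Prop) (phi : {rmorphism B -> {poly B}}) (pi : {rmorphism B -> B}).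
Hypothesis expphi : is_exp_map A phi.
Hypothesis invA : forall b, A b <-> invariants phi b.
Hypothesis AC : forall r, A (C r).
Hypothesis Api : forall b, A (pi b).
Hypothesis piA : forall a, A a -> pi a = a.
Variables (F : B) (N : nat) (c : 'I_N -> R) (m : 'I_N -> B) (E : 'I_N -> B -> B) (i0 : 'I_N).
Hypothesis F0 : F != 0.
Hypothesis piF : pi F = 0.
Hypothesis FE : F = \sum_i C (c i) * m i.
Hypothesis EE : forall i b, C (c i) * (b - pi b) = F * E i b.
Hypothesis ci0 : c i0 != 0.

Lemma quot_sub i x y : E i (x - y) = E i x - E i y.
Proof. by apply: (mulfI F0); rewrite mulrBr -!EE rmorphB; ring. Qed.

Lemma quot_mul i x y : E i (x * y) = E i x * y + pi x * E i y.
Proof.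
apply: (mulfI F0); rewrite mulrDr -EE mulrA -EE (mulrCA F) -EE rmorphM; ring.
Qed.

Lemma quot_fixed i a : A a -> E i a = 0.
Proof. by move=> Aa; apply: (mulfI F0); rewrite -EE piA // subrr !mulr0. Qed.

Lemma quot_scale i a b : A a -> E i (a * b) = a * E i b.
Proof. by move=> Aa; rewrite quot_mul quot_fixed // mul0r add0r piA. Qed.

Lemma quot_sum i (I : finType) (G : I -> B) : E i (\sum_k G k) = \sum_k E i (G k).
Proof.
have E0 : E i 0 = 0 by have := quot_sub i 0 0; rewrite !subrr.
apply: (big_morph (E i) _ E0) => x y.
by rewrite -[y in LHS]opprK quot_sub -[- y]sub0r quot_sub E0 sub0r opprK.
Qed.

Lemma quot_swap i k b : C (c k) * E i b = C (c i) * E k b.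
Proof. apply: (mulfI F0); transitivity (C (c k) * (C (c i) * (b - pi b))).
  by rewrite EE; ring.
by transitivity (C (c i) * (C (c k) * (b - pi b))); [ring | rewrite EE; ring]. Qed.

(** [F] is not invariant, since otherwise [F = pi F = 0]; so [phi F] has positive degree in [U], and
    division by [F] lowers the degree. *)
Lemma quot_size i b k : (size (phi b) <= k.+1)%N -> (size (phi (E i b)) <= k)%N.
Proof.
move=> szb; have [_ phi0 _] := expphi.
have phiA a : A a -> phi a = a%:P by move/invA.
have [->|Eb0] := eqVneq (E i b) 0; first by rewrite rmorph0 size_poly0.
have nz x : x != 0 -> phi x != 0.
  by apply: contra_neq => E0; rewrite -(phi0 x) E0 horner0.
have szF : (1 < size (phi F))%N.
  rewrite ltnNge; apply/negP => /size1_polyC E1; case/eqP: F0.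
  have EF := phi0 F; rewrite E1 hornerC in EF.
  by rewrite -[LHS]piA ?piF //; apply/invA; rewrite /invariants E1 EF.
have : (size (phi F * phi (E i b))%R <= k.+1)%N.
  rewrite -rmorphM -EE rmorphM rmorphB (phiA _ (AC _)) (phiA _ (Api b)).
  have [-> | ci] := eqVneq (C (c i)) 0; first by rewrite mul0r size_poly0.
  rewrite size_Cmul //; apply: leq_trans (size_polyD _ _) _.
  by rewrite geq_max szb size_polyN (leq_trans (size_polyC_leq1 _)).
rewrite size_mul ?nz //; move: szF; move: (size (phi F)) (size (phi (E i b))) => u v.
lia.
Qed.

(** Both sides equal [E i F], since [pi F = 0]. *)
Lemma quot_F i : C (c i) = \sum_j C (c j) * E i (m j).
Proof.
apply: (mulfI F0); transitivity (F * E i F); first by rewrite -EE piF subr0 mulrC.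
by congr (_ * _); rewrite {1}FE quot_sum; apply: eq_bigr => j _; apply: quot_scale.
Qed.

Let d := c i0.
Let r j := eps (pi (E i0 (m j))).

(** This is [quot_F] at [i0], pushed down to [R] by [pi] and [eps]. *)
Lemma dual_basis : \sum_j c j * r j = d.
Proof.
transitivity (eps (pi (\sum_j C (c j) * E i0 (m j)))); last by rewrite -quot_F piA // epsC.
rewrite !rmorph_sum; apply: eq_bigr => j _.
by rewrite !rmorphM (piA (AC _)) epsC.
Qed.

(** This is [d] times the inverse of the ideal generated by all [c k]. *)
Definition sym_ideal (x : R) : Prop := forall k, divs d (c k * x).

Lemma sym_ideal_ideal : is_ideal sym_ideal.
Proof.
split=> [k|x y Ix Iy k|a x Ix k]; first by exists 0; rewrite !mulr0.
- have [u Eu] := Ix k; have [v Ev] := Iy k; exists (u + v).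
  by rewrite !mulrDr Eu Ev.
- by have [u Eu] := Ix k; exists (a * u); rewrite mulrCA Eu mulrCA.
Qed.

Lemma sym_ideal_dual j : sym_ideal (r j).
Proof.
move=> k; exists (eps (pi (E k (m j)))).
have := congr1 (eps \o pi) (quot_swap i0 k (m j)).
by rewrite /= !rmorphM !(piA (AC _)) !epsC.
Qed.

Lemma sym_ideal_invertible : invertible_ideal sym_ideal.
Proof.
split; first exact: sym_ideal_ideal.
pose tf := @FracField.tofrac R.
have tfd : tf d != 0 by rewrite tofrac_eq0.
(* The inverse is taken as large as possible. It contains every [c j / d], and [dual_basis] writes
   [1] with these; [d] is a common denominator because it lies in [sym_ideal]. *)
exists (fun y => forall x, sym_ideal x -> exists z, tf x * y = tf z); split; last split; last split.
- split; last split.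
  + by move=> x _; exists 0; rewrite mulr0 /tf rmorph0.
  + move=> y z Jy Jz x Ix; have [u Eu] := Jy x Ix; have [v Ev] := Jz x Ix.
    by exists (u + v); rewrite mulrDr Eu Ev /tf rmorphD.
  + move=> a y Jy x Ix; have [u Eu] := Jy x Ix; exists (a * u).
    by rewrite mulrCA Eu /tf rmorphM.
- exists d; split=> // y Jy; apply: Jy => k; exists (c k); exact: mulrC.
- by move=> x y Ix Jy; apply: Jy.
exists [seq (r j, tf (c j) / tf d) | j <- enum 'I_N]; split.
  move=> _ /mapP[j _ ->]; split=> /=; first exact: sym_ideal_dual.
  move=> x Ix; have [y Ey] := Ix j; exists y.
  by rewrite mulrA -tofracM (mulrC x) Ey tofracM mulrAC divff // mul1r.
rewrite big_map big_enum /= (eq_bigr (fun j => tf (c j * r j) / tf d)).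
  by rewrite -mulr_suml -rmorph_sum dual_basis divff.
by move=> j _; rewrite mulrA -tofracM (mulrC (r j)).
Qed.

(** Convertible with [ext_ideal] when [B] is [mpoly R n] and [C] is [mpolyC n]. *)
Definition sym_module (x : B) : Prop :=
  exists s : seq (R * B),
    (forall p, p \in s -> sym_ideal p.1 /\ A p.2) /\ x = \sum_(p <- s) C p.1 * p.2.

Lemma sym_module_scale a x : A a -> sym_module x -> sym_module (a * x).
Proof.
move=> Aa [s [Is ->]]; exists [seq (p.1, a * p.2) | p <- s]; split.
  by move=> _ /mapP[p /Is[Ip Ap] ->]; split=> //=; apply: invariants_mul invA _ _ Aa Ap.
by rewrite big_map mulr_sumr; apply: eq_bigr => p _; rewrite mulrCA.
Qed.

Lemma sym_module_add x y : sym_module x -> sym_module y -> sym_module (x + y).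
Proof.
move=> [s [Is ->]] [t [It ->]]; exists (s ++ t); rewrite big_cat; split=> // p.
by rewrite mem_cat => /orP[/Is|/It].
Qed.

Lemma sym_module_dual j : sym_module (C (r j)).
Proof.
exists [:: (r j, 1)]; rewrite big_seq1 mulr1; split=> // p; rewrite inE => /eqP ->.
by split; [apply: sym_ideal_dual | apply: invariants1 invA].
Qed.

Lemma sym_module_coef k x : sym_module x -> exists2 y, A y & C (c k) * x = C d * y.
Proof.
move=> [s [Is ->]]; elim: s Is => [|p s IHs] Is.
  by exists 0; [apply: invariants0 invA | rewrite big_nil !mulr0].
have [|y Ay Ey] := IHs; first by move=> q qs; apply: Is; rewrite inE qs orbT.
have [Ip Ap] := Is p (mem_head _ _); have [z Ez] := Ip k.
exists (C z * p.2 + y).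
  rewrite -[y]opprK -[- y]sub0r; do 2?[apply: (invariants_sub invA) => //].
    exact: (invariants_mul invA).
  exact: (invariants0 invA).
by rewrite big_cons mulrDr Ey mulrA -rmorphM Ez rmorphM; ring.
Qed.

(** The quotient [x * F / d] is the sum of the [(c k * x / d) * m k], and [d] divides each
    [c k * x]. *)
Lemma sym_gen_exists : exists j : B -> B, forall x, sym_module x -> C d * j x = x * F.
Proof.
suff /choice[j jP] : forall x, exists y, sym_module x -> C d * y = x * F by exists j.
move=> x; have [Mx|nMx] := pselect (sym_module x); last by exists 0.
have /choice[y yP] : forall k, exists y, C (c k) * x = C d * y.
  by move=> k; have [y _ ?] := sym_module_coef k Mx; exists y.
exists (\sum_k y k * m k) => _; rewrite FE !mulr_sumr; apply: eq_bigr => k _.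
by rewrite mulrA -yP; ring.
Qed.

Variable j : B -> B.
Hypothesis jE : forall x, sym_module x -> C d * j x = x * F.

Let Cd0 : C d != 0. Proof. by rewrite C_eq0. Qed.

Lemma pi_gen x : sym_module x -> pi (j x) = 0.
Proof.
move=> Mx; apply: (mulfI Cd0); have := congr1 pi (jE Mx).
by rewrite !rmorphM piF (piA (AC _)) !mulr0.
Qed.

Lemma quot_gen i x : sym_module x -> C d * E i (j x) = C (c i) * x.
Proof.
move=> Mx; apply: (mulfI F0).
by rewrite mulrCA -EE pi_gen // subr0 mulrCA jE //; ring.
Qed.

(** Multiplied by [d], each summand becomes [c k * r k * (b - pi b)], and [dual_basis] adds these
    up. As [E k] lowers the degree, iteration generates [B] from [A] and the image of [j]. *)
Lemma gen_decomposition b : b = pi b + \sum_k j (C (r k)) * E k b.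
Proof.
apply: (mulfI Cd0); rewrite mulrDr mulr_sumr.
rewrite (eq_bigr (fun k => C (c k * r k) * (b - pi b))).
  by rewrite -mulr_suml -rmorph_sum dual_basis; ring.
move=> k _; rewrite mulrA jE; last exact: sym_module_dual.
by rewrite -mulrA -EE rmorphM; ring.
Qed.

Section Extension.
Variables (T : comNzRingType) (sigma f : B -> T).
Hypothesis sigma1 : sigma 1 = 1.
Hypothesis sigmaD : forall a b, A a -> A b -> sigma (a + b) = sigma a + sigma b.
Hypothesis sigmaM : forall a b, A a -> A b -> sigma (a * b) = sigma a * sigma b.
Hypothesis fD : forall x y, sym_module x -> sym_module y -> f (x + y) = f x + f y.
Hypothesis fZ : forall a x, A a -> sym_module x -> f (a * x) = sigma a * f x.

Let sigmaB a b : A a -> A b -> sigma (a - b) = sigma a - sigma b.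
Proof.
move=> Aa Ab; have Aab := invariants_sub invA Aa Ab.
by rewrite -[in sigma a](subrK b a) (sigmaD Aab Ab) addrK.
Qed.

(** The value that [gen_decomposition] forces on a morphism extending [sigma] and sending [j x] to
    [f x]. The fuel [k] is meant to bound the size of [phi b], so zero fuel concerns only
    [b = 0]. *)
Fixpoint extend k (b : B) : T :=
  if k is k'.+1 then sigma (pi b) + \sum_i f (C (r i)) * extend k' (E i b) else 0.

Let extendB k x y : extend k (x - y) = extend k x - extend k y.
Proof.
elim: k x y => [|k IHk] x y /=; first by rewrite subr0.
rewrite rmorphB sigmaB // opprD [RHS]addrACA -sumrB; congr (_ + _).
by apply: eq_bigr => i _; rewrite quot_sub IHk mulrBr.
Qed.

Let extend0 k : extend k 0 = 0.
Proof. by have := extendB k 0 0; rewrite !subrr. Qed.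

Let extendZ k a b : A a -> extend k (a * b) = sigma a * extend k b.
Proof.
move=> Aa; elim: k b => [|k IHk] b /=; first by rewrite mulr0.
rewrite rmorphM piA // sigmaM // mulrDr mulr_sumr; congr (_ + _).
by apply: eq_bigr => i _; rewrite quot_scale // IHk mulrCA.
Qed.

Let size_phi_eq0 b : (size (phi b) <= 0)%N -> b = 0.
Proof.
have [_ phi0 _] := expphi; rewrite leqn0 size_poly_eq0 => /eqP E0.
by rewrite -(phi0 b) E0 horner0.
Qed.

Let extend_stable k l b : (size (phi b) <= k)%N -> extend (k + l) b = extend k b.
Proof.
elim: k b => [|k IHk] b szb /=; first by rewrite (size_phi_eq0 szb) extend0.
by congr (_ + _); apply: eq_bigr => i _; rewrite IHk // quot_size.
Qed.

Let g b := extend (size (phi b)) b.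

Let gE k b : (size (phi b) <= k)%N -> g b = extend k b.
Proof. by move=> szb; rewrite -(subnKC szb) extend_stable. Qed.

Let gB x y : g (x - y) = g x - g y.
Proof.
pose k := maxn (size (phi x)) (size (phi y)).
rewrite (@gE k x) ?leq_maxl // (@gE k y) ?leq_maxr // -extendB; apply: gE.
by rewrite rmorphB; apply: leq_trans (size_polyD _ _) _; rewrite size_polyN.
Qed.

Let gZ a b : A a -> g (a * b) = sigma a * g b.
Proof.
move=> Aa; pose k := maxn (size (phi (a * b))) (size (phi b)).
by rewrite (@gE k (a * b)) ?leq_maxl // (@gE k b) ?leq_maxr // extendZ.
Qed.

Let g_rec b : g b = sigma (pi b) + \sum_i f (C (r i)) * g (E i b).
Proof.
rewrite (@gE (size (phi b)).+1) //=; congr (_ + _); apply: eq_bigr => i _.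
by rewrite (@gE (size (phi b))) // quot_size.
Qed.

Let g_fixed a : A a -> g a = sigma a.
Proof.
move=> Aa; rewrite g_rec big1 ?addr0 ?piA // => i _.
by rewrite quot_fixed // /g extend0 mulr0.
Qed.

Let gD x y : g (x + y) = g x + g y.
Proof.
have g0 : g 0 = 0 by have := gB 0 0; rewrite !subrr.
by rewrite -[in LHS](opprK y) gB -[- y]sub0r gB g0 sub0r opprK.
Qed.

(** By induction on the degree of [phi x], through the twisted Leibniz rule [quot_mul]. *)
Let gM x y : g (x * y) = g x * g y.
Proof.
have [k szx] : exists k, (size (phi x) <= k)%N by exists (size (phi x)).
elim: k x szx => [|k IHk] x szx.
  by rewrite (size_phi_eq0 szx) mul0r /g extend0 mul0r.
have sumM : \sum_i f (C (r i)) * g (E i (x * y)) =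
    (\sum_i f (C (r i)) * g (E i x)) * g y + sigma (pi x) * \sum_i f (C (r i)) * g (E i y).
  rewrite mulr_suml mulr_sumr -big_split; apply: eq_bigr => i _ /=.
  by rewrite quot_mul gD (gZ _ (Api x)) IHk ?quot_size //; ring.
have := g_rec y; have := g_rec x; rewrite [g (x * y)]g_rec sumM rmorphM sigmaM //.
by move: (\sum_i _) (\sum_i _) => u v -> ->; ring.
Qed.

Lemma sym_extension : exists h : {rmorphism B -> T},
  (forall a, A a -> h a = sigma a) /\ (forall x, sym_module x -> h (j x) = f x).
Proof.
have [//||h hE] := @rmorphism_of B T g.
  split=> //; rewrite g_fixed //; exact: (invariants1 invA).
exists h; split=> [a Aa|x Mx]; first by rewrite hE g_fixed.
have f0 : f 0 = 0.
  have A0 := invariants0 invA; have M0 : sym_module 0 by exists [::]; rewrite big_nil.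
  by apply: (addrI (f 0)); rewrite -fD // !addr0.
have sigma0 : sigma 0 = 0.
  have A0 := invariants0 invA.
  by apply: (addrI (sigma 0)); rewrite -sigmaD // !addr0.
(* The quotient [y k] of [c k * x] by [d] is [E k (j x)] and lies in [A]; [dual_basis] expands [x]
   as the sum of the [y k * r k], so one step of [g_rec] gives [f x]. *)
have /choice[y yP] : forall k, exists y, A y /\ C (c k) * x = C d * y.
  by move=> k; have [y Ay ?] := sym_module_coef k Mx; exists y.
have Ej i : E i (j x) = y i by apply: (mulfI Cd0); rewrite quot_gen // (yP i).2.
have Ex : x = \sum_i y i * C (r i).
  apply: (mulfI Cd0); rewrite mulr_sumr -[in LHS]dual_basis rmorph_sum mulr_suml.
  by apply: eq_bigr => i _; rewrite rmorphM mulrA -(yP i).2; ring.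
have fsum (I : finType) (G : I -> B) : (forall i, sym_module (G i)) ->
    f (\sum_i G i) = \sum_i f (G i).
  move=> MG; suff [] : f (\sum_i G i) = \sum_i f (G i) /\ sym_module (\sum_i G i) by [].
  apply: (big_rec2 (fun u v => f v = u /\ sym_module v)).
    by split=> //; exists [::]; rewrite big_nil.
  by move=> i u v _ [<- Mv]; rewrite fD //; split=> //; apply: sym_module_add.
rewrite hE g_rec pi_gen // sigma0 add0r {2}Ex fsum.
  apply: eq_bigr => i _; have [Ay _] := yP i.
  by rewrite Ej g_fixed // fZ //; [exact: mulrC | exact: sym_module_dual].
by move=> i; apply: sym_module_scale (yP i).1 (sym_module_dual i).
Qed.

Lemma sym_extension_unique (g1 g2 : {rmorphism B -> T}) :
  (forall a, A a -> g1 a = g2 a) -> (forall x, sym_module x -> g1 (j x) = g2 (j x)) ->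
  g1 =1 g2.
Proof.
move=> gA gj b; have [k szb] : exists k, (size (phi b) <= k)%N by exists (size (phi b)).
elim: k b szb => [|k IHk] b szb; first by rewrite (size_phi_eq0 szb) !rmorph0.
rewrite (gen_decomposition b) !rmorphD !rmorph_sum gA //; congr (_ + _).
apply: eq_bigr => i _; rewrite !rmorphM gj; last exact: sym_module_dual.
by congr (_ * _); apply: IHk; apply: quot_size.
Qed.
End Extension.
End SymmetricAlgebra.

(** * The equivalence *)

(** [pi] kills [b - pi b], hence the product of its prime factors; in a domain it then kills one of
    them. *)
Lemma exists_prime_kernel (B : idomainType) (S : B -> Prop) (pi : {rmorphism B -> B}) b :
  mult_set S -> factorial_upto S -> (forall s, S s -> pi s = s) -> (forall b, pi (pi b) = pi b) ->
  pi b != b -> exists2 F, prime_upto S F & pi F = 0.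
Proof.
move=> [_ _ S0] facS piS pi_idem neb.
have [|ps [prps [s [t [Ss St E]]]]] := facS (b - pi b).
  by rewrite subr_eq0 eq_sym.
have /esym/eqP := congr1 pi E; rewrite !rmorphM rmorphB pi_idem subrr mulr0 rmorph_prod.
rewrite mulf_eq0 piS // (negPf (S0 _ St)) /= prodf_seq_eq0 => /hasP[F Fps /eqP piF].
by exists F; first exact: prps.
Qed.

Lemma retract_invariants_sym_alg (R : idomainType) (n : nat) (A : mpoly R n -> Prop)
    (phi : {rmorphism mpoly R n -> {poly mpoly R n}}) :
  noetherian R -> normal_domain R -> R_subalgebra A -> is_retract A ->
  is_exp_map A phi -> (forall b, A b <-> invariants phi b) -> ~ (forall b, phi b = b%:P) ->
  exists I : R -> Prop, invertible_ideal I /\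
    exists j : mpoly R n -> mpoly R n, is_sym_alg A (ext_ideal I A) j.
Proof.
move=> noethR normR [AC _ _ _] [pi [pi_idem Aim]] expphi invA phi_neq.
have Api b : A (pi b) by apply/Aim; exists b.
have piA a : A a -> pi a = a by case/Aim => b <-.
have multS := nzconst_mult R n.
have SA s : nzconst s -> A s by case/nzconstP => r _ ->.
(* If [pi] were the identity, [A] would be the whole ring and [phi] trivial. *)
have [b neb] : exists b, pi b != b.
  apply: contrapT => nb; apply: phi_neq => b; apply/invA/Aim; exists b.
  by apply: contrapT => /eqP neb; apply: nb; exists b.
have [F prF piF] := exists_prime_kernel multS (@mpoly_factorial R n)
  (fun s Ss => piA s (SA s Ss)) pi_idem neb.
have F0 := prF.1.
(* [F] divides [h] up to a constant [d], and [content_dvd] trades [d] for any coefficient of [F]. *)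
have kernel t h : t \in mterms F -> pi h = 0 -> exists e, mpolyC n t.1 * h = F * e.
  move=> tF pih.
  have [_ [e [/nzconstP[d d0 ->] E]]] := prime_upto_kernel_dvd expphi invA multS piA SA prF piF pih.
  have [|g Eg] := content_dvd noethR normR d0 (_ : divs (mpolyC n d) (F * e)) tF.
    by exists h.
  exists g; apply: (mulfI (_ : mpolyC n d != 0)); first by rewrite mpolyC_eq0.
  by rewrite mulrCA E mulrCA Eg mulrCA.
pose N := size (mterms F); pose t i := tnth (in_tuple (mterms F)) i.
pose c (i : 'I_N) := (t i).1; pose m (i : 'I_N) := (t i).2.
have FE : F = \sum_i mpolyC n (c i) * m i.
  by rewrite [LHS]mtermsE big_tnth.
have [i0 ci0] : exists i, c i != 0.
  apply: contrapT => nc; case/eqP: F0; rewrite FE big1 // => i _.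
  have [->|ci] := eqVneq (c i) 0; first by rewrite rmorph0 mul0r.
  by case: nc; exists i.
have /choice[E EE] : forall ib : 'I_N * mpoly R n,
    exists e, mpolyC n (c ib.1) * (ib.2 - pi ib.2) = F * e.
  move=> [i x]; apply: kernel; first exact: mem_tnth.
  by rewrite rmorphB pi_idem subrr.
have {}EE i x : mpolyC n (c i) * (x - pi x) = F * E (i, x) by apply: (EE (i, x)).
have [eps epsC] := mpoly_augmentation R n.
have C_eq0 (r : R) : (mpolyC n r == 0) = (r == 0) := mpolyC_eq0 n r.
exists (sym_ideal c i0); split.
  exact: (sym_ideal_invertible epsC AC piA F0 piF FE EE ci0).
have [j jE] := sym_gen_exists invA AC i0 FE.
have d0 : mpolyC n (c i0) != 0 by rewrite C_eq0.
exists j; split; last split.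
- move=> x y Mx My; apply: (mulfI d0).
  by rewrite mulrDr !jE ?mulrDl //; apply: sym_module_add.
- move=> a x Aa Mx; apply: (mulfI d0).
  by rewrite mulrCA !jE ?mulrA //; exact: (sym_module_scale invA Aa Mx).
move=> T sigma f sigma1 sigmaD sigmaM fD fZ; split.
  exact: (sym_extension C_eq0 epsC expphi invA AC Api piA F0 piF FE EE ci0 jE
            sigma1 sigmaD sigmaM fD fZ).
move=> g1 g2 g1A g1M g2A g2M.
apply: (sym_extension_unique C_eq0 epsC expphi invA AC Api piA F0 piF FE EE ci0 jE).
  by move=> a Aa; rewrite g1A // g2A.
by move=> x Mx; rewrite g1M // g2M.
Qed.

(** * Symmetric algebras give retracts and exponential maps *)

Section Subring.
Variables (B : comNzRingType) (A : B -> Prop).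
Hypotheses (A1 : A 1) (AB : forall x y, A x -> A y -> A (x - y)).
Hypothesis AM : forall x y, A x -> A y -> A (x * y).

Definition subring_pred : {pred B} := fun b => `[<A b>].

Lemma subring_pred_closed : subring_closed subring_pred.
Proof.
split=> [|x y /asboolP Ax /asboolP Ay|x y /asboolP Ax /asboolP Ay]; apply/asboolP => //.
  exact: AB.
exact: AM.
Qed.

Record subring_type := Subring { subring_val : B; _ : subring_val \in subring_pred }.

HB.instance Definition _ := [isSub for subring_val].
HB.instance Definition _ := [Choice of subring_type by <:].
HB.instance Definition _ :=
  GRing.isSubringClosed.Build B subring_pred subring_pred_closed.
HB.instance Definition _ := [SubChoice_isSubComNzRing of subring_type by <:].

(** The retraction comes from the universal property with [A] itself as target, which must be a ring
    type. *)
Lemma subring_exists : exists (T : comNzRingType) (v : {rmorphism T -> B}),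
  [/\ injective v, forall t, A (v t) & forall a, A a -> exists t, v t = a].
Proof.
exists subring_type, (val : {rmorphism subring_type -> B}); split; first exact: val_inj.
  by case=> b bA; apply/asboolP.
by move=> a Aa; exists (Subring (asboolT Aa)).
Qed.
End Subring.

Section SymmetricAlgebraRetract.
Variables (B : idomainType) (A M : B -> Prop) (j : B -> B) (i : B).
Hypotheses (A1 : A 1) (AB : forall x y, A x -> A y -> A (x - y)).
Hypothesis AM : forall x y, A x -> A y -> A (x * y).
Hypothesis MA : forall x, M x -> A x.
Hypotheses (Mi : M i) (i0 : i != 0).
Hypothesis symj : is_sym_alg A M j.

Lemma sym_alg_unique (T : comNzRingType) (g1 g2 : {rmorphism B -> T}) :
  (forall a, A a -> g1 a = g2 a) -> (forall x, M x -> g1 (j x) = g2 (j x)) -> g1 =1 g2.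
Proof.
move=> gA gM; have [jD [jZ UP]] := symj.
have [] := UP T g2 (fun x => g2 (j x)).
- exact: rmorph1.
- by move=> *; rewrite rmorphD.
- by move=> *; rewrite rmorphM.
- by move=> x y Mx My; rewrite jD ?rmorphD.
- by move=> a x Aa Mx; rewrite jZ ?rmorphM.
by move=> _ /(_ g1 g2); apply.
Qed.

Lemma sym_alg_retraction : exists pi : {rmorphism B -> B},
  [/\ forall b, A (pi b), forall a, A a -> pi a = a & forall x, M x -> pi (j x) = 0].
Proof.
have [T [v [injv Av vA]]] := subring_exists A1 AB AM.
have /choice[sigma sigmaP] : forall a, exists t, A a -> v t = a.
  by move=> a; have [/vA[t]|nAa] := pselect (A a); [exists t | exists 0].
have A0 : A 0 by rewrite -(subrr 1); apply: AB.
have AD x y : A x -> A y -> A (x + y).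
  by move=> Ax Ay; rewrite -[y]opprK -[- y]sub0r; do 2?apply: AB => //.
have [_ [_ /(_ T sigma (fun=> 0))[]]] := symj.
- by apply: injv; rewrite sigmaP ?rmorph1.
- by move=> a b Aa Ab; apply: injv; rewrite rmorphD !sigmaP //; apply: AD.
- by move=> a b Aa Ab; apply: injv; rewrite rmorphM !sigmaP //; apply: AM.
- by move=> *; rewrite addr0.
- by move=> *; rewrite mulr0.
move=> [g [gA gM]] _; exists (v \o g : {rmorphism B -> B}); split=> /= [b|a Aa|x Mx].
- exact: Av.
- by rewrite gA ?sigmaP.
- by rewrite gM ?rmorph0.
Qed.

Lemma sym_alg_translation : exists phi : {rmorphism B -> {poly B}},
  (forall a, A a -> phi a = a%:P) /\ (forall x, M x -> phi (j x) = (j x)%:P + x%:P * 'X).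
Proof.
have [jD [jZ UP]] := symj.
have [] // := UP {poly B} polyC (fun x => (j x)%:P + x%:P * 'X).
- by move=> *; rewrite polyCD.
- by move=> *; rewrite polyCM.
- by move=> x y Mx My; rewrite jD // !polyCD; ring.
- by move=> a x Aa Mx; rewrite jZ // !polyCM; ring.
Qed.

(** Both remaining axioms compare ring morphisms that agree on [A], so by [sym_alg_unique] it
    suffices to evaluate them at the elements [j x]. *)
Lemma translation_exp_map (phi : {rmorphism B -> {poly B}}) :
  (forall a, A a -> phi a = a%:P) -> (forall x, M x -> phi (j x) = (j x)%:P + x%:P * 'X) ->
  is_exp_map A phi.
Proof.
move=> phiA phij; split=> // b.
  apply: (sym_alg_unique (g1 := horner_eval 0 \o phi) (g2 := idfun)) => /= [a Aa|x Mx].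
    by rewrite /horner_eval phiA // hornerC.
  by rewrite /horner_eval phij // hornerD hornerM hornerX mulr0 addr0 hornerC.
apply: (sym_alg_unique (g1 := map_poly phi \o phi)
          (g2 := comp_poly ('X + 'X%:P) \o map_poly polyC \o phi)) => /= [a Aa|x Mx].
  by rewrite phiA // !map_polyC /= phiA // comp_polyC.
rewrite phij // !rmorphD !rmorphM /= !map_polyC !map_polyX /= phij // (phiA x (MA Mx)).
rewrite comp_polyC comp_polyX comp_polyC rmorphD rmorphM; ring.
Qed.

(* Over the fraction field, translating by [- j i / i] kills every [j x], so it is the
   retraction. *)
Lemma translation_invariant (phi : {rmorphism B -> {poly B}}) b :
  (forall a, A a -> phi a = a%:P) -> (forall x, M x -> phi (j x) = (j x)%:P + x%:P * 'X) ->
  phi b = b%:P -> A b.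
Proof.
move=> phiA phij phib; have [pi [Api piA pij]] := sym_alg_retraction.
pose tf := @FracField.tofrac B; pose u := - (tf (j i) / tf i).
have tfi : tf i != 0 by rewrite tofrac_eq0.
have [_ [jZ _]] := symj.
have E := @sym_alg_unique _ (horner_eval u \o map_poly tf \o phi : {rmorphism _ -> _})
  (tf \o pi : {rmorphism _ -> _}).
have /= := E _ _ b; rewrite /horner_eval phib map_polyC hornerC /= => Eb.
suff -> : b = pi b by [].
apply/eqP; rewrite -tofrac_eq; apply/eqP; apply: Eb => [a Aa|x Mx].
  by rewrite phiA // map_polyC hornerC piA.
rewrite phij // pij // rmorphD rmorphM /= !map_polyC map_polyX hornerD hornerM hornerX !hornerC.
rewrite rmorph0; apply: (mulfI tfi).
rewrite mulr0 /u mulrDr !mulrN (mulrCA (tf i)) (mulrC (tf i) (_ / _)) divfK // -!tofracM.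
(* [i * j x = j (i * x) = x * j i], because both [i] and [x] lie in [A]. *)
by rewrite -(jZ _ _ (MA Mi) Mx) -(jZ _ _ (MA Mx) Mi) mulrC subrr.
Qed.

Lemma sym_alg_retract : is_retract A.
Proof.
have [pi [Api piA _]] := sym_alg_retraction; exists pi; split=> b; first by rewrite piA.
by split=> [Ab|[c <-]]; [exists b; apply: piA | apply: Api].
Qed.

Lemma sym_alg_exp_map : exists phi : {rmorphism B -> {poly B}},
  [/\ is_exp_map A phi, forall b, A b <-> invariants phi b & ~ (forall b, phi b = b%:P)].
Proof.
have [phi [phiA phij]] := sym_alg_translation; exists phi; split.
- exact: translation_exp_map.
- by move=> b; split; [apply: phiA | apply: translation_invariant].
(* The coefficient of [U] in [phi (j i)] is [i], which is nonzero. *)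
move=> /(_ (j i)); rewrite phij // => /(congr1 (coefp 1%N)) /=.
by rewrite coefD coefMX !coefC /= add0r; apply/eqP.
Qed.
End SymmetricAlgebraRetract.

Lemma invertible_ideal_neq0 (R : idomainType) (I : R -> Prop) :
  invertible_ideal I -> exists2 i, I i & i != 0.
Proof.
move=> [_ [J [_ [_ [_ [s [Is Es]]]]]]]; apply: contrapT => nI.
have /eqP := Es; rewrite big_seq big1 ?(eq_sym 0) ?oner_eq0 // => p ps.
have [Ip _] := Is p ps; have [->|p0] := eqVneq p.1 0; first by rewrite rmorph0 mul0r.
by case: nI; exists p.1.
Qed.

Theorem theorem4p5 (R : idomainType) (n : nat) (A : mpoly R n -> Prop) :
  noetherian R -> normal_domain R -> R_subalgebra A ->
  ((is_retract A /\
      exists phi : {rmorphism mpoly R n -> {poly mpoly R n}},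
        [/\ is_exp_map A phi,
            (forall b, A b <-> invariants phi b) &
            ~ (forall b, phi b = b%:P)])
   <->
   (exists I : R -> Prop, invertible_ideal I /\
      exists j : mpoly R n -> mpoly R n, is_sym_alg A (ext_ideal I A) j)).
Proof.
move=> noethR normR subA; split=> [[retA [phi [expphi invA phi_neq]]]|].
  exact: retract_invariants_sym_alg retA expphi invA phi_neq.
move=> [I [invI [j symj]]]; have [i Ii i0] := invertible_ideal_neq0 invI.
have [AC AD AN AM] := subA.
have A1 : A 1 by rewrite -(rmorph1 (mpolyC n)); apply: AC.
have AB x y : A x -> A y -> A (x - y) by move=> Ax Ay; apply: AD => //; apply: AN.
have MA x : ext_ideal I A x -> A x.
  move=> [s [Is ->]]; rewrite big_seq; apply: (big_ind A).
  - by rewrite -(subrr 1); apply: AB.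
  - exact: AD.
  - by move=> p /Is[_ Ap]; apply: AM.
have Mi : ext_ideal I A (mpolyC n i).
  exists [:: (i, 1)]; rewrite big_seq1 mulr1; split=> // p.
  by rewrite inE => /eqP ->.
have ni0 : mpolyC n i != 0 by rewrite mpolyC_eq0.
split; first exact: sym_alg_retract A1 AB AM symj.
exact: sym_alg_exp_map A1 AB AM MA Mi ni0 symj.
Qed.
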